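(* Let $Q,N\in\mathbb{N}$, let $(a_n)_{n\in\mathbb{Z}[i]}$ be any sequence of complex numbers, put $Z=\sum_{n\in\mathbb{Z}[i],\ \mathcal{N}(n)\le N}|a_n|^2$, let $\mathcal{S}\subseteq B(0,Q^{1/2})\cap(\mathbb{Z}[i]\setminus\{0\})$ and let $X\ge1$. Suppose that $$A_t(u,k,l)\le\Big(1+\frac{|\mathcal{S}_t|/\mathcal{N}(k)}{Q/|t|^2}\,u^2\Big)X$$ holds for all $t\in\mathbb{Z}[i]\setminus\{0\}$ with $|t|\le N^{1/4}$, all $k\in\mathbb{Z}[i]\setminus\{0\}$ with $|k|\le N^{1/4}/|t|$, all $l\in\mathbb{Z}[i]$ with $(k,l)=1$, and all real $u$ with $|k|\sqrt{Q}/(2N^{1/4})\le u\le \sqrt{Q}/|t|$. Then for every $\varepsilon>0$ there is a constant $c_2>0$ depending only on $\varepsilon$ such that $$\sum_{q\in\mathcal{S}}\ \sum_{\substack{a\bmod q\\ (a,q)=1}}\Big|\sum_{\substack{n\in\mathbb{Z}[i]\\ \mathcal{N}(n)\le N}} a_n\, e\Big(\Re\Big(\frac{na}{q}\Big)\Big)\Big|^2\le c_2\Big(N+QXN^{\varepsilon}\big(\sqrt{N}+|\mathcal{S}|\big)\Big)Z.$$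
   Context: $e(x)=e^{2\pi i x}$. $\mathbb{Z}[i]$ denotes the Gaussian integers and $\mathcal{N}(q)=\Re(q)^2+\Im(q)^2$. For $y\in\mathbb{C}$, $u\ge0$, $B(y,u)=\{w\in\mathbb{C}:|w-y|\le u\}$. ''$a\bmod q$, $(a,q)=1$'' means $a$ runs over a complete system of residues modulo $q$ in $\mathbb{Z}[i]$ coprime to $q$. For $t\in\mathbb{Z}[i]\setminus\{0\}$, $\mathcal{S}_t=\{q\in\mathbb{Z}[i]: tq\in\mathcal{S}\}$, and for $u\ge0$, $k\in\mathbb{Z}[i]\setminus\{0\}$, $l\in\mathbb{Z}[i]$, $$A_t(u,k,l)=\sup_{y\in\mathbb{C},\ |y|\le \sqrt{Q}/|t|}\big|\{q\in\mathcal{S}_t\cap B(y,u): q\equiv l \bmod k\}\big|.$$ *)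

(* Defs.v *)
From Stdlib Require Import Reals ZArith List Lia ClassicalDescription.
From Coquelicot Require Import Coquelicot.
Import ListNotations.
Open Scope R_scope.

(** Gaussian integers as pairs (x, y) standing for x + i y. *)
Definition GI := (Z * Z)%type.
Definition g0 : GI := (0%Z, 0%Z).
Definition gmul (a b : GI) : GI :=
  ((fst a * fst b - snd a * snd b)%Z, (fst a * snd b + snd a * fst b)%Z).
Definition gsub (a b : GI) : GI := ((fst a - fst b)%Z, (snd a - snd b)%Z).
Definition gnorm (a : GI) : Z := (fst a * fst a + snd a * snd a)%Z.
Definition toC (a : GI) : C := (IZR (fst a), IZR (snd a)).
Definition gdvd (d b : GI) : Prop := exists m : GI, b = gmul d m.
Definition gcong (a b q : GI) : Prop := gdvd q (gsub a b).
Definition gunit (d : GI) : Prop := gnorm d = 1%Z.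
Definition gcoprime (a b : GI) : Prop :=
  forall d, gdvd d a -> gdvd d b -> gunit d.

Definition complete_residues (q : GI) (r : list GI) : Prop :=
  (forall a : GI, exists b, In b r /\ gcong a b q) /\
  ForallOrdPairs (fun b c => ~ gcong b c q) r.

Definition ee (x : R) : C := (cos (2 * PI * x), sin (2 * PI * x)).

Definition sumR {A} (l : list A) (f : A -> R) : R :=
  fold_right (fun x acc => f x + acc) 0 l.
Definition sumC {A} (l : list A) (f : A -> C) : C :=
  fold_right (fun x acc => Cplus (f x) acc) (RtoC 0) l.
Definition dec (P : Prop) : bool :=
  if excluded_middle_informative P then true else false.
Definition countP {A} (l : list A) (P : A -> Prop) : nat :=
  length (filter (fun x => dec (P x)) l).

Definition zrange (M : nat) : list Z :=
  map (fun k => (Z.of_nat k - Z.of_nat M)%Z) (seq 0 (2 * M + 1)).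
Definition gbox (M : nat) : list GI := list_prod (zrange M) (zrange M).

Definition gdisc (N : nat) : list GI :=
  filter (fun n => (gnorm n <=? Z.of_nat N)%Z) (gbox N).

Definition gabs (q : GI) : R := sqrt (IZR (gnorm q)).

(** Here S : GI -> bool is a subset of B(0, sqrt Q) \ {0}; every element of S
    and of S_t (t <> 0) then lies in the box [-Q, Q]^2, so counting over that
    box computes the exact cardinalities. *)
Definition card_S (Q : nat) (S : GI -> bool) : nat :=
  countP (gbox Q) (fun q => S q = true).
Definition card_St (Q : nat) (S : GI -> bool) (t : GI) : nat :=
  countP (gbox Q) (fun q => S (gmul t q) = true).

Definition A_t (Q : nat) (S : GI -> bool) (t : GI) (u : R) (k l : GI) : Rbar :=
  Lub_Rbar (fun r => exists y : C, Cmod y <= sqrt (INR Q) / gabs t /\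
     r = INR (countP (gbox Q)
              (fun q => S (gmul t q) = true /\ Cmod (Cminus (toC q) y) <= u
                        /\ gcong q l k))).

Definition expsum (N : nat) (a : GI -> C) (q b : GI) : C :=
  sumC (gdisc N) (fun n => Cmult (a n) (ee (Re (Cdiv (Cmult (toC n) (toC b)) (toC q))))).

(* Main.v *)
(** Duality and a Fejer-type kernel on Z^2 bound the left side by O(K N Z), where K is the largest number of
    fractions a/q, with q in S and a prime to q, in a disc of radius N^(-1/2) about a point alpha.

    To bound K, put T = N^(1/4) and approximate alpha by b/r with |r| <= T and |r alpha - b| <= 4/T. A fraction
    a/q near alpha is determined by q and m = a r - b q. If m = 0 then q and r are associates, so this happens
    at most four times. Otherwise let t = gcd(q, r), r = t k, q = t q', m = t m'. For fixed t and m', all q' lie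
    in one residue class prime to k and in a disc of radius 2 sqrt Q |k| / (T^2 w), where
    w = max(|r alpha - b|, 2 |r| / T^2), so the hypothesis on A_t applies; the number of m' is
    O(Q w^2 / |t|^2). Summing over m' and over the divisors t of r, whose number is O(N^eps), gives
    K = O(1 + Q X N^eps (N^(-1/2) + |S| / N)). *)

Require Import Defs.
From Stdlib Require Import Reals ZArith List Lia Lra Psatz Classical ClassicalDescription.
From Stdlib Require FinFun.
From Coquelicot Require Import Coquelicot.
Import ListNotations.
Open Scope R_scope.

(** * Divisors in the Gaussian integers *)

(** The hypothesis on A_t is available only for u between |k| sqrt Q / (2 T) and sqrt Q / |t|, and
    this shapes the argument. For the radius u = 2 sqrt Q |k| / (T^2 w) the lower end says exactly w
    <= 4 / T, so an approximation error of 4 / T is precisely affordable; the upper end says exactly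
    w >= 2 |r| / T^2, which is why w is a maximum and not just |r alpha - b|. The number of m' grows
    like w^2, while the second term of the bound for one m' decays like w^(-2): in the product w
    survives only in the first term, where w <= 4 / T is used. There is no room for an additive
    constant in the count of m', and treating m = 0 apart removes it. Points live on the torus R^2 /
    Z^2, whereas the approximation argument works in the plane; each fraction is therefore replaced
    by a translate by a Gaussian integer before it is counted. *)

Definition g1 : GI := (1%Z, 0%Z).
Definition gadd (a b : GI) : GI := ((fst a + fst b)%Z, (snd a + snd b)%Z).
Definition gopp (a : GI) : GI := ((- fst a)%Z, (- snd a)%Z).

Lemma GI_ring : ring_theory g0 g1 gadd gmul gsub gopp (@eq GI).
Proof.
  constructor; intros; repeat match goal with x : GI |- _ => destruct x end;
    cbv [g0 g1 gadd gmul gsub gopp fst snd]; f_equal; ring.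
Qed.
Add Ring GI_ring_inst : GI_ring.

Lemma gnorm_mul a b : gnorm (gmul a b) = (gnorm a * gnorm b)%Z.
Proof. destruct a, b; unfold gnorm, gmul; simpl; ring. Qed.

Lemma gnorm_ge0 a : (0 <= gnorm a)%Z.
Proof. unfold gnorm; nia. Qed.

Lemma gnorm_eq0 a : gnorm a = 0%Z -> a = g0.
Proof. destruct a as [x y]; unfold gnorm, g0; simpl; intros; f_equal; nia. Qed.

Lemma gnorm_pos a : a <> g0 -> (1 <= gnorm a)%Z.
Proof.
  intros H. pose proof (gnorm_ge0 a). destruct (Z.eq_dec (gnorm a) 0) as [E|E].
  - now apply gnorm_eq0 in E.
  - lia.
Qed.

Lemma gmul_eq0 a b : gmul a b = g0 -> a = g0 \/ b = g0.
Proof.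
  intros H. apply (f_equal gnorm) in H. rewrite gnorm_mul in H.
  change (gnorm g0) with 0%Z in H. apply Z.mul_eq_0 in H.
  destruct H as [H|H]; [left|right]; now apply gnorm_eq0.
Qed.

Lemma gmul_neq0_l a b : gmul a b <> g0 -> a <> g0.
Proof. intros H E; apply H; rewrite E; ring. Qed.

Lemma gmul_neq0_r a b : gmul a b <> g0 -> b <> g0.
Proof. intros H E; apply H; rewrite E; ring. Qed.

Lemma gmul_cancel a b c : a <> g0 -> gmul a b = gmul a c -> b = c.
Proof.
  intros Ha H. assert (E : gmul a (gsub b c) = g0).
  { transitivity (gsub (gmul a b) (gmul a c)); [ring|rewrite H; ring]. }
  apply gmul_eq0 in E. destruct E as [E|E]; [tauto|].
  transitivity (gadd (gsub b c) c); [ring|rewrite E; ring].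
Qed.

Lemma gdvd_refl a : gdvd a a.
Proof. exists g1; ring. Qed.

Lemma gdvd_trans a b c : gdvd a b -> gdvd b c -> gdvd a c.
Proof. intros [x ->] [y ->]. exists (gmul x y). ring. Qed.

Lemma gdvd_mul_l a b c : gdvd a b -> gdvd a (gmul c b).
Proof. intros [x ->]. exists (gmul c x). ring. Qed.

Lemma gdvd_mul_r a b c : gdvd a b -> gdvd a (gmul b c).
Proof. intros [x ->]. exists (gmul x c). ring. Qed.

Lemma gdvd_add a b c : gdvd a b -> gdvd a c -> gdvd a (gadd b c).
Proof. intros [x ->] [y ->]. exists (gadd x y). ring. Qed.

Lemma gdvd_sub a b c : gdvd a b -> gdvd a c -> gdvd a (gsub b c).
Proof. intros [x ->] [y ->]. exists (gsub x y). ring. Qed.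

Lemma gdvd_neq0 a b : gdvd a b -> b <> g0 -> a <> g0.
Proof. intros [x ->] H. eapply gmul_neq0_l; eauto. Qed.

Definition gunits : list GI := [(1,0); (-1,0); (0,1); (0,-1)]%Z.

Lemma gunit_in a : gunit a -> In a gunits.
Proof.
  destruct a as [x y]. unfold gunit, gnorm, gunits; simpl; intros H.
  assert (-1 <= x <= 1)%Z by nia. assert (-1 <= y <= 1)%Z by nia.
  assert (Hx : x = (-1)%Z \/ x = 0%Z \/ x = 1%Z) by lia.
  assert (Hy : y = (-1)%Z \/ y = 0%Z \/ y = 1%Z) by lia.
  destruct Hx as [->|[->| ->]]; destruct Hy as [->|[->| ->]]; simpl in H; try lia; tauto.
Qed.

Lemma gunit_dvd u a : gunit u -> gdvd u a.
Proof.
  (* A unit has norm 1, so its conjugate is its inverse. *)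
  intros H. exists (gmul (fst u, (- snd u)%Z) a).
  assert (E : gmul u (fst u, (- snd u)%Z) = g1).
  { unfold gunit, gnorm in H. unfold gmul, g1; simpl. f_equal; [rewrite <- H|]; ring. }
  transitivity (gmul (gmul u (fst u, (- snd u)%Z)) a); [rewrite E; ring|ring].
Qed.

Lemma gdvd_g1_unit u : gdvd u g1 -> gunit u.
Proof.
  intros [v H]. apply (f_equal gnorm) in H. rewrite gnorm_mul in H.
  change (gnorm g1) with 1%Z in H. unfold gunit.
  symmetry in H. apply Z.eq_mul_1_nonneg in H; [tauto|apply gnorm_ge0].
Qed.

(** [u] and [v] are the coordinates of a times the conjugate of b. Rounding [u / n] and [v / n] to
    nearest integers leaves a remainder of norm at most n / 2. *)
Lemma gdivide a b : b <> g0 -> exists q, (gnorm (gsub a (gmul b q)) < gnorm b)%Z.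
Proof.
  intros Hb. pose proof (gnorm_pos b Hb) as Hn.
  set (n := gnorm b) in *.
  set (u := (fst a * fst b + snd a * snd b)%Z).
  set (v := (snd a * fst b - fst a * snd b)%Z).
  assert (Hr : forall w : Z, exists c : Z, (-n <= 2 * (w - n * c) <= n)%Z).
  { intros w. exists ((2 * w + n) / (2 * n))%Z.
    pose proof (Z.div_mod (2 * w + n) (2 * n) ltac:(lia)) as E.
    pose proof (Z.mod_pos_bound (2 * w + n) (2 * n) ltac:(lia)). lia. }
  destruct (Hr u) as [c1 H1], (Hr v) as [c2 H2]. exists (c1, c2).
  assert (E : (n * gnorm (gsub a (gmul b (c1, c2)))
               = (u - n * c1) * (u - n * c1) + (v - n * c2) * (v - n * c2))%Z).
  { unfold n, u, v, gnorm, gsub, gmul; simpl; ring. }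
  assert ((4 * ((u - n * c1) * (u - n * c1)) <= n * n)%Z) by nia.
  assert ((4 * ((v - n * c2) * (v - n * c2)) <= n * n)%Z) by nia.
  nia.
Qed.

Lemma gbezout_norm : forall (n : nat) a b, (gnorm b <= Z.of_nat n)%Z ->
  exists x y, let d := gadd (gmul a x) (gmul b y) in gdvd d a /\ gdvd d b.
Proof.
  induction n as [|n IH]; intros a b Hn.
  - exists g1, g0. assert (b = g0) as -> by (apply gnorm_eq0; pose proof (gnorm_ge0 b); lia).
    simpl. split; [exists g1; ring|exists g0; ring].
  - destruct (classic (b = g0)) as [->|Hb].
    { exists g1, g0. simpl. split; [exists g1; ring|exists g0; ring]. }
    destruct (gdivide a b Hb) as [q Hq].
    destruct (IH b (gsub a (gmul b q))) as (x & y & H1 & H2); [lia|].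
    exists y, (gsub x (gmul q y)).
    cbv zeta in *.
    replace (gadd (gmul a y) (gmul b (gsub x (gmul q y))))
      with (gadd (gmul b x) (gmul (gsub a (gmul b q)) y)) by ring.
    split; [|assumption].
    replace a with (gadd (gsub a (gmul b q)) (gmul b q)) at 2 by ring.
    apply gdvd_add; [assumption|]. now apply gdvd_mul_r.
Qed.

Lemma gbezout a b : exists x y, let d := gadd (gmul a x) (gmul b y) in gdvd d a /\ gdvd d b.
Proof.
  apply (gbezout_norm (Z.to_nat (gnorm b))). rewrite Z2Nat.id; [lia|apply gnorm_ge0].
Qed.

Lemma gcoprime_sym a b : gcoprime a b -> gcoprime b a.
Proof. unfold gcoprime; auto. Qed.

Lemma gauss a b c : gcoprime a b -> gdvd a (gmul b c) -> gdvd a c.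
Proof.
  intros H Hd. destruct (gbezout a b) as (x & y & H1 & H2); cbv zeta in *.
  pose proof (H _ H1 H2) as Hu.
  set (d := gadd (gmul a x) (gmul b y)) in *.
  destruct (gunit_dvd d c Hu) as [m ->]. unfold d.
  replace (gmul (gadd (gmul a x) (gmul b y)) m)
    with (gadd (gmul a (gmul x m)) (gmul y (gmul b m))) by ring.
  (* The hypothesis speaks of b d m; multiplying by the inverse [v] of [d] recovers b m. *)
  destruct (gunit_dvd d g1 Hu) as [v Hv].
  replace (gmul b m) with (gmul v (gmul b (gmul d m))).
  2:{ transitivity (gmul (gmul d v) (gmul b m)); [ring|rewrite <- Hv; ring]. }
  apply gdvd_add; [exists (gmul x m); ring|].
  apply gdvd_mul_l, gdvd_mul_l, Hd.
Qed.

Lemma gcd_split a b : b <> g0 ->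
  exists t a' b', a = gmul t a' /\ b = gmul t b' /\ gcoprime a' b'.
Proof.
  intros Hb. destruct (gbezout a b) as (x & y & H1 & H2); cbv zeta in *.
  set (t := gadd (gmul a x) (gmul b y)) in *.
  pose proof (gdvd_neq0 _ _ H2 Hb) as Ht.
  destruct H1 as [a' Ha], H2 as [b' Hb'].
  exists t, a', b'. repeat split; try assumption.
  intros d D1 D2. apply gdvd_g1_unit.
  assert (E : g1 = gadd (gmul a' x) (gmul b' y)).
  { apply (gmul_cancel t); [assumption|].
    transitivity t; [ring|]. unfold t at 1. rewrite Ha at 1. rewrite Hb' at 1. ring. }
  rewrite E. apply gdvd_add; now apply gdvd_mul_r.
Qed.

(** * Irreducible elements and the divisor bound *)

Definition girr (p : GI) := p <> g0 /\ ~ gunit p /\ forall d, gdvd d p -> gunit d \/ gdvd p d.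

Lemma girr_exists : forall (n : nat) r, (gnorm r <= Z.of_nat n)%Z -> r <> g0 -> ~ gunit r ->
  exists p, girr p /\ gdvd p r.
Proof.
  induction n as [|n IH]; intros r Hn Hr Hu.
  { pose proof (gnorm_pos r Hr). lia. }
  destruct (classic (girr r)) as [H|H].
  { exists r; split; [assumption|apply gdvd_refl]. }
  assert (exists d, gdvd d r /\ ~ gunit d /\ ~ gdvd r d) as (d & D1 & D2 & D3).
  { apply NNPP; intros K. apply H. repeat split; try assumption.
    intros d Hd. apply NNPP; intros K'. apply K. exists d; tauto. }
  pose proof (gdvd_neq0 _ _ D1 Hr) as Hd.
  destruct (IH d) as (p & P1 & P2); try assumption.
  - destruct D1 as [m ->]. rewrite gnorm_mul in Hn.
    assert (gnorm m <> 1%Z).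
    { intros E. apply D3. destruct (gunit_dvd m g1 E) as [v Hv].
      exists v. transitivity (gmul d (gmul m v)); [rewrite <- Hv; ring|ring]. }
    pose proof (gnorm_pos m (gmul_neq0_r _ _ Hr)). pose proof (gnorm_pos d Hd). nia.
  - exists p; split; [assumption|]. eapply gdvd_trans; eauto.
Qed.

Lemma girr_coprime p t : girr p -> ~ gdvd p t -> gcoprime t p.
Proof.
  intros (H0 & H1 & H2) Hp d D1 D2. destruct (H2 d D2) as [K|K]; [assumption|].
  exfalso; apply Hp; eapply gdvd_trans; eauto.
Qed.

Fixpoint gpow (p : GI) (e : nat) : GI :=
  match e with O => g1 | S e => gmul p (gpow p e) end.

(** As long as p divides t, cancel it on both sides; once it does not, t is prime to p and Gauss's
    lemma strips the remaining powers of p. Hence passing from s to p^e s multiplies the number of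
    divisors by at most e + 1. *)
Lemma gdvd_gpow_mul p s : girr p -> forall e t, gdvd t (gmul (gpow p e) s) ->
  exists j t', (j <= e)%nat /\ t = gmul (gpow p j) t' /\ gdvd t' s.
Proof.
  intros Hp. induction e as [|e IH]; intros t Ht; simpl in Ht.
  - exists O, t. repeat split; [lia|simpl; ring|].
    now replace s with (gmul g1 s) by ring.
  - destruct (classic (gdvd p t)) as [[t1 ->]|Hn].
    + destruct (IH t1) as (j & t' & J1 & J2 & J3).
      { destruct Ht as [m Hm]. exists m. apply (gmul_cancel p); [apply Hp|].
        transitivity (gmul (gmul p (gpow p e)) s); [ring|rewrite Hm; ring]. }
      exists (S j), t'. repeat split; [lia| |assumption]. rewrite J2; simpl; ring.
    + destruct (IH t) as (j & t' & J1 & J2 & J3).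
      { apply (gauss _ p); [now apply girr_coprime|].
        now replace (gmul p (gmul (gpow p e) s)) with (gmul (gmul p (gpow p e)) s) by ring. }
      exists j, t'; repeat split; [lia|assumption|assumption].
Qed.

Lemma gpow_extract p : girr p -> forall (n : nat) r, (gnorm r <= Z.of_nat n)%Z -> r <> g0 ->
  exists e s, r = gmul (gpow p e) s /\ ~ gdvd p s.
Proof.
  intros Hp. induction n as [|n IH]; intros r Hn Hr.
  { pose proof (gnorm_pos r Hr). lia. }
  destruct (classic (gdvd p r)) as [[s ->]|K].
  - assert (Hs : s <> g0) by (eapply gmul_neq0_r; eauto).
    destruct (IH s) as (e & s' & E1 & E2); [|assumption|].
    + destruct Hp as (P0 & P1 & _). unfold gunit in P1.
      rewrite gnorm_mul in Hn. pose proof (gnorm_pos p P0).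
      pose proof (gnorm_pos s Hs). nia.
    + exists (S e), s'. split; [rewrite E1; simpl; ring|assumption].
  - exists O, r. split; [simpl; ring|assumption].
Qed.

Lemma gnorm_gpow p e : IZR (gnorm (gpow p e)) = IZR (gnorm p) ^ e.
Proof.
  induction e as [|e IH]; simpl; [reflexivity|]. now rewrite gnorm_mul, mult_IZR, IH.
Qed.

(** Only an upper bound for the number of divisors: the list may have repetitions and entries that
    do not divide r. *)
Definition has_divisors (r : GI) (c : R) : Prop :=
  exists l, (forall t, gdvd t r -> In t l) /\ INR (length l) <= c.

Lemma has_divisors_gpow p e s c : girr p -> has_divisors s c ->
  has_divisors (gmul (gpow p e) s) ((INR e + 1) * c).
Proof.
  intros Hp (l & L1 & L2).
  exists (map (fun x => gmul (gpow p (fst x)) (snd x)) (list_prod (seq 0 (Datatypes.S e)) l)).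
  split.
  - intros t Ht. destruct (gdvd_gpow_mul p s Hp e t Ht) as (j & t' & J1 & J2 & J3).
    apply in_map_iff. exists (j, t'). split; [now rewrite J2|].
    apply in_prod; [apply in_seq; lia|now apply L1].
  - rewrite length_map, length_prod, length_seq, mult_INR, S_INR.
    apply Rmult_le_compat_l; [pose proof (pos_INR e); lra|assumption].
Qed.

(* From norm [small_norm eps] on, an irreducible [p] has [e + 1 <= norm p ^ (e * eps)]; a smaller one needs the
   extra factor [small_weight eps]. *)
Definition small_norm (eps : R) : R := exp (/ eps).
Definition small_weight (eps : R) : R := Rmax 1 (/ (eps * ln 2)).

Lemma ln2_pos : 0 < ln 2.
Proof. rewrite <- ln_1. apply ln_increasing; lra. Qed.

Lemma Rpower_pow_ge (eps x : R) (e : nat) : 0 < x -> 1 + INR e * (eps * ln x) <= Rpower (x ^ e) eps.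
Proof.
  intros Hx. rewrite <- Rpower_pow by assumption. rewrite Rpower_mult.
  unfold Rpower. replace (INR e * (eps * ln x)) with (INR e * eps * ln x) by ring.
  (* [exp_ineq1] is strict and excludes the exponent 0. *)
  destruct (Req_dec (INR e * eps * ln x) 0) as [E|E].
  - rewrite E, exp_0; lra.
  - apply Rlt_le, exp_ineq1; assumption.
Qed.

Lemma weight_large (eps x : R) (e : nat) : 0 < eps -> small_norm eps <= x -> INR e + 1 <= Rpower (x ^ e) eps.
Proof.
  intros Heps Hx. unfold small_norm in Hx. assert (0 < exp (/ eps)) by apply exp_pos.
  eapply Rle_trans; [|apply Rpower_pow_ge; lra].
  assert (1 <= eps * ln x).
  { assert (/ eps <= ln x). { rewrite <- (ln_exp (/ eps)). apply ln_le; assumption. }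
    replace 1 with (eps * / eps) by (field; lra). apply Rmult_le_compat_l; lra. }
  pose proof (pos_INR e). nra.
Qed.

(** The weight is at least 1 and at least 1 / (eps ln 2), so it lifts 1 + e eps ln 2 above 1 + e. *)
Lemma weight_small (eps x : R) (e : nat) : 0 < eps -> 2 <= x ->
  INR e + 1 <= small_weight eps * Rpower (x ^ e) eps.
Proof.
  intros Heps Hx. set (B := small_weight eps). pose proof ln2_pos. pose proof (pos_INR e).
  assert (0 < eps * ln 2) by (apply Rmult_lt_0_compat; lra).
  assert (1 <= B) by apply Rmax_l. assert (/ (eps * ln 2) <= B) by apply Rmax_r.
  assert (ln 2 <= ln x) by (apply ln_le; lra).
  assert (1 + INR e * (eps * ln 2) <= Rpower (x ^ e) eps).
  { eapply Rle_trans; [|apply Rpower_pow_ge; lra].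
    apply Rplus_le_compat_l, Rmult_le_compat_l; [lra|]. apply Rmult_le_compat_l; lra. }
  assert (1 <= B * (eps * ln 2)).
  { replace 1 with (/ (eps * ln 2) * (eps * ln 2)) by (field; lra).
    apply Rmult_le_compat_r; lra. }
  apply Rle_trans with (B * (1 + INR e * (eps * ln 2))).
  - nra.
  - apply Rmult_le_compat_l; lra.
Qed.

(* [L] is a list of the irreducibles of small norm that may still divide [r]; each costs a factor [B], once. *)
Lemma has_divisors_small eps : 0 < eps -> forall (n : nat) r (L : list GI),
  (gnorm r <= Z.of_nat n)%Z -> r <> g0 ->
  (forall p, girr p -> gdvd p r -> IZR (gnorm p) < small_norm eps -> In p L) ->
  has_divisors r (4 * small_weight eps ^ length L * Rpower (IZR (gnorm r)) eps).
Proof.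
  intros Heps. set (B := small_weight eps). set (P0 := small_norm eps).
  assert (HB : 1 <= B) by apply Rmax_l.
  induction n as [|n IH]; intros r L Hn Hr HL.
  { pose proof (gnorm_pos r Hr). lia. }
  (* The divisors of a unit are the four units; this is the factor 4 in the bound. *)
  destruct (classic (gunit r)) as [Hu|Hu].
  - exists gunits. split.
    + intros t Ht. apply gunit_in, gdvd_g1_unit. eapply gdvd_trans; [exact Ht|].
      now apply gunit_dvd.
    + rewrite Hu. unfold Rpower. rewrite ln_1, Rmult_0_r, exp_0.
      pose proof (pow_R1_Rle B (length L) HB). simpl. lra.
  - destruct (girr_exists (Datatypes.S n) r Hn Hr Hu) as (p & Hp & Hd).
    destruct (gpow_extract p Hp (Datatypes.S n) r Hn Hr) as (e & s & E & Hs).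
    assert (Hs0 : s <> g0) by (rewrite E in Hr; eapply gmul_neq0_r; eauto).
    (* A positive power of p leaves r, so s has smaller norm and the induction hypothesis
       applies. *)
    assert (He : e <> O).
    { intros ->. apply Hs. rewrite E in Hd. simpl in Hd.
      now replace s with (gmul g1 s) by ring. }
    assert (Hp2 : (2 <= gnorm p)%Z).
    { destruct Hp as (H0 & H1 & _). pose proof (gnorm_pos p H0). unfold gunit in H1. lia. }
    assert (Hns : (gnorm s <= Z.of_nat n)%Z).
    { destruct e as [|e]; [tauto|]. rewrite E in Hn. simpl in Hn. rewrite !gnorm_mul in Hn.
      pose proof (gnorm_pos s Hs0).
      assert (gpow p e <> g0).
      { intros K. rewrite E in Hr; apply Hr. simpl. rewrite K. ring. }
      pose proof (gnorm_pos _ H0).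
      assert (2 <= gnorm p * gnorm (gpow p e))%Z by nia. nia. }
    assert (Hsd : forall q, gdvd q s -> gdvd q r).
    { intros q Hq. rewrite E. now apply gdvd_mul_l. }
    assert (H2 : 2 <= IZR (gnorm p)) by now apply IZR_le.
    assert (Hsn : 0 < IZR (gnorm s)) by (apply IZR_lt; pose proof (gnorm_pos s Hs0); lia).
    assert (Hpn : 0 < IZR (gnorm p) ^ e) by (apply pow_lt; lra).
    rewrite E at 2. rewrite gnorm_mul, mult_IZR, gnorm_gpow, <- Rpower_mult_distr by assumption.
    assert (Hps : 0 < Rpower (IZR (gnorm s)) eps) by apply exp_pos.
    assert (Hpp : 0 < Rpower (IZR (gnorm p) ^ e) eps) by apply exp_pos.
    pose proof (pos_INR e).
    destruct (Rle_lt_dec P0 (IZR (gnorm p))) as [Hl|Hl].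
    + destruct (has_divisors_gpow p e s _ Hp (IH s L Hns Hs0 ltac:(auto))) as (l & L1 & L2).
      rewrite <- E in L1. exists l; split; [assumption|].
      eapply Rle_trans; [exact L2|].
      pose proof (weight_large eps _ e Heps Hl). pose proof (pow_R1_Rle B (length L) HB).
      replace (4 * B ^ length L * (Rpower (IZR (gnorm p) ^ e) eps * Rpower (IZR (gnorm s)) eps))
        with (Rpower (IZR (gnorm p) ^ e) eps * (4 * B ^ length L * Rpower (IZR (gnorm s)) eps)) by ring.
      apply Rmult_le_compat_r; [|assumption].
      apply Rmult_le_pos; lra.
    + assert (Hin : In p L) by auto.
      destruct (in_split _ _ Hin) as (L1 & L2 & EL).
      (* Since p does not divide s, it can be struck from the list. *)
      assert (HL' : forall q, girr q -> gdvd q s -> IZR (gnorm q) < P0 -> In q (L1 ++ L2)).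
      { intros q Q1 Q2 Q3. pose proof (HL q Q1 (Hsd q Q2) Q3) as K. rewrite EL in K.
        apply in_app_or in K. apply in_or_app. destruct K as [K|[K|K]]; auto.
        subst q; tauto. }
      destruct (has_divisors_gpow p e s _ Hp (IH s _ Hns Hs0 HL')) as (l & D1 & D2).
      rewrite <- E in D1. exists l; split; [assumption|].
      eapply Rle_trans; [exact D2|].
      assert (EB : B ^ length L = B * B ^ length (L1 ++ L2)).
      { rewrite EL, !length_app. simpl. rewrite Nat.add_succ_r. reflexivity. }
      rewrite EB.
      pose proof (weight_small eps _ e Heps H2). pose proof (pow_R1_Rle B (length (L1 ++ L2)) HB).
      replace (4 * (B * B ^ length (L1 ++ L2)) * (Rpower (IZR (gnorm p) ^ e) eps * Rpower (IZR (gnorm s)) eps))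
        with ((B * Rpower (IZR (gnorm p) ^ e) eps) * (4 * B ^ length (L1 ++ L2) * Rpower (IZR (gnorm s)) eps)) by ring.
      apply Rmult_le_compat_r; [|assumption].
      apply Rmult_le_pos; lra.
Qed.

Lemma in_zrange M x : In x (zrange M) <-> (- Z.of_nat M <= x <= Z.of_nat M)%Z.
Proof.
  unfold zrange. rewrite in_map_iff. split.
  - intros (k & <- & Hk). apply in_seq in Hk. lia.
  - intros H. exists (Z.to_nat (x + Z.of_nat M)). split; [lia|]. apply in_seq. lia.
Qed.

Lemma in_gbox M g : (gnorm g < (Z.of_nat M + 1) * (Z.of_nat M + 1))%Z -> In g (gbox M).
Proof.
  destruct g as [x y]. unfold gnorm; simpl; intros H.
  pose proof (Z.square_nonneg x). pose proof (Z.square_nonneg y).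
  apply in_prod; apply in_zrange; split; nia.
Qed.

(** The list of possible small irreducibles is taken to be a whole box that contains every Gaussian
    integer of norm below exp (1 / eps). It does not depend on r, hence neither does C. *)
Lemma divisor_bound eps : 0 < eps -> exists C, 0 < C /\
  forall r, r <> g0 -> has_divisors r (C * Rpower (IZR (gnorm r)) eps).
Proof.
  intros He. destruct (nfloor_ex (exp (/ eps))) as [M HM]; [left; apply exp_pos|].
  set (B := small_weight eps).
  exists (4 * B ^ length (gbox (Datatypes.S M))). split.
  - apply Rmult_lt_0_compat; [lra|]. apply pow_lt. pose proof (Rmax_l 1 (/ (eps * ln 2))). unfold B, small_weight; lra.
  - intros r Hr. apply (has_divisors_small eps He (Z.to_nat (gnorm r))); [|assumption|].
    + rewrite Z2Nat.id; [lia|apply gnorm_ge0].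
    + intros p _ _ Hp. apply in_gbox.
      assert (IZR (gnorm p) < IZR (Z.of_nat (Datatypes.S M))) as K%lt_IZR.
      { rewrite <- INR_IZR_INZ, S_INR. unfold small_norm in Hp. lra. }
      nia.
Qed.

(** * Finite sums and the Dirichlet kernel *)

Lemma sumR_app {A} (l1 l2 : list A) f : sumR (l1 ++ l2) f = sumR l1 f + sumR l2 f.
Proof. induction l1 as [|x l1 IH]; simpl; [ring|rewrite IH; ring]. Qed.

Lemma sumR_ext {A} (l : list A) f g : (forall x, In x l -> f x = g x) -> sumR l f = sumR l g.
Proof.
  induction l as [|x l IH]; simpl; intros H; [reflexivity|].
  rewrite (H x), IH; auto.
Qed.

Lemma sumR_le {A} (l : list A) f g : (forall x, In x l -> f x <= g x) -> sumR l f <= sumR l g.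
Proof.
  induction l as [|x l IH]; simpl; intros H; [lra|].
  apply Rplus_le_compat; auto.
Qed.

Lemma sumR_const {A} (l : list A) c : sumR l (fun _ => c) = INR (length l) * c.
Proof.
  induction l as [|x l IH]; [simpl; ring|].
  change (c + sumR l (fun _ => c) = INR (S (length l)) * c). rewrite IH, S_INR. ring.
Qed.

Lemma sumR_nonneg {A} (l : list A) f : (forall x, In x l -> 0 <= f x) -> 0 <= sumR l f.
Proof.
  intros H. replace 0 with (sumR l (fun _ => 0)) by (rewrite sumR_const; ring).
  now apply sumR_le.
Qed.

Lemma sumR_plus {A} (l : list A) f g : sumR l (fun x => f x + g x) = sumR l f + sumR l g.
Proof. induction l as [|x l IH]; simpl; [ring|rewrite IH; ring]. Qed.

Lemma sumR_scal {A} (l : list A) c f : sumR l (fun x => c * f x) = c * sumR l f.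
Proof. induction l as [|x l IH]; simpl; [ring|rewrite IH; ring]. Qed.

Lemma sumR_swap {A B} (l : list A) (l' : list B) f :
  sumR l (fun x => sumR l' (fun y => f x y)) = sumR l' (fun y => sumR l (fun x => f x y)).
Proof.
  induction l as [|x l IH]; simpl; [rewrite sumR_const; ring|].
  now rewrite IH, sumR_plus.
Qed.

Lemma sumR_map {A B} (h : A -> B) l f : sumR (map h l) f = sumR l (fun x => f (h x)).
Proof. induction l as [|x l IH]; simpl; [reflexivity|now rewrite IH]. Qed.

Lemma sumR_filter {A} (p : A -> bool) l f :
  sumR (filter p l) f = sumR l (fun x => if p x then f x else 0).
Proof.
  induction l as [|x l IH]; simpl; [reflexivity|].
  destruct (p x); simpl; rewrite IH; ring.
Qed.

Lemma sumR_list_prod {A B} (l : list A) (l' : list B) f :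
  sumR (list_prod l l') f = sumR l (fun x => sumR l' (fun y => f (x, y))).
Proof.
  induction l as [|x l IH]; simpl; [reflexivity|].
  now rewrite sumR_app, sumR_map, IH.
Qed.

Lemma sumR_incl {A} (l l' : list A) f : NoDup l -> incl l l' -> (forall x, 0 <= f x) ->
  sumR l f <= sumR l' f.
Proof.
  intros Hl; revert l'. induction Hl as [|x l Hx Hl IH]; intros l' Hi Hf; simpl.
  - apply sumR_nonneg; auto.
  - destruct (in_split x l') as (l1 & l2 & ->); [apply Hi; now left|].
    rewrite sumR_app; simpl.
    assert (sumR l f <= sumR (l1 ++ l2) f).
    { apply IH; [|assumption]. intros y Hy.
      assert (K : In y (l1 ++ x :: l2)) by (apply Hi; now right).
      apply in_app_or in K. apply in_or_app. destruct K as [K|[K|K]]; auto. subst; tauto. }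
    rewrite sumR_app in H. lra.
Qed.

Lemma dec_true (P : Prop) : dec P = true <-> P.
Proof. unfold dec. destruct excluded_middle_informative; split; intros; auto; discriminate. Qed.

(** [R] is a relation and not a function: an x related to several labels is counted several times,
    which an upper bound tolerates. This allows sorting by a gcd that is unique only up to units. *)
Lemma sumR_fiber {A B} (R : A -> B -> Prop) (l : list A) (l' : list B) F :
  (forall x, In x l -> exists b, In b l' /\ R x b) -> (forall x, 0 <= F x) ->
  sumR l F <= sumR l' (fun b => sumR (filter (fun x => dec (R x b)) l) F).
Proof.
  intros H HF.
  rewrite (sumR_ext l' _ (fun b => sumR l (fun x => if dec (R x b) then F x else 0)))
    by (intros; apply sumR_filter).
  rewrite sumR_swap. apply sumR_le. intros x Hx.
  destruct (H x Hx) as (b & Hb & Hxb).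
  apply Rle_trans with (sumR [b] (fun b => if dec (R x b) then F x else 0)).
  - simpl. rewrite (proj2 (dec_true _) Hxb). lra.
  - apply sumR_incl.
    + constructor; [auto|constructor].
    + intros y [<-|[]]; auto.
    + intros y. destruct (dec (R x y)); [apply HF|lra].
Qed.

Lemma length_fiber {A B} (R : A -> B -> Prop) (l : list A) (l' : list B) (c : Rdefinitions.R) :
  (forall x, In x l -> exists b, In b l' /\ R x b) ->
  (forall b, In b l' -> INR (countP l (fun x => R x b)) <= c) ->
  INR (length l) <= INR (length l') * c.
Proof.
  intros H Hc. rewrite <- (Rmult_1_r (INR (length l))), <- !sumR_const.
  eapply Rle_trans; [apply (sumR_fiber R l l'); [assumption|intros; lra]|].
  apply sumR_le. intros b Hb. rewrite sumR_const, Rmult_1_r. now apply Hc.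
Qed.

Lemma sumC_app {A} (l1 l2 : list A) f : sumC (l1 ++ l2) f = Cplus (sumC l1 f) (sumC l2 f).
Proof. induction l1 as [|x l1 IH]; simpl; [ring|rewrite IH; ring]. Qed.

Lemma sumC_ext {A} (l : list A) f g : (forall x, f x = g x) -> sumC l f = sumC l g.
Proof. intros H. induction l as [|x l IH]; simpl; [reflexivity|]. now rewrite H, IH. Qed.

Lemma sumC_0 {A} (l : list A) : sumC l (fun _ => RtoC 0) = RtoC 0.
Proof. induction l as [|x l IH]; simpl; [reflexivity|rewrite IH; ring]. Qed.

Lemma sumC_plus {A} (l : list A) f g :
  sumC l (fun x => Cplus (f x) (g x)) = Cplus (sumC l f) (sumC l g).
Proof. induction l as [|x l IH]; simpl; [ring|rewrite IH; ring]. Qed.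

Lemma sumC_scal {A} (l : list A) c f : sumC l (fun x => Cmult c (f x)) = Cmult c (sumC l f).
Proof. induction l as [|x l IH]; simpl; [ring|rewrite IH; ring]. Qed.

Lemma sumC_swap {A B} (l : list A) (l' : list B) f :
  sumC l (fun x => sumC l' (fun y => f x y)) = sumC l' (fun y => sumC l (fun x => f x y)).
Proof.
  induction l as [|x l IH]; simpl; [now rewrite sumC_0|].
  now rewrite IH, sumC_plus.
Qed.

Lemma sumC_map {A B} (h : A -> B) l f : sumC (map h l) f = sumC l (fun x => f (h x)).
Proof. induction l as [|x l IH]; simpl; [reflexivity|now rewrite IH]. Qed.

Lemma sumC_list_prod {A B} (l : list A) (l' : list B) f :
  sumC (list_prod l l') f = sumC l (fun x => sumC l' (fun y => f (x, y))).
Proof.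
  induction l as [|x l IH]; simpl; [reflexivity|].
  now rewrite sumC_app, sumC_map, IH.
Qed.

Lemma sumC_conj {A} (l : list A) f : Cconj (sumC l f) = sumC l (fun x => Cconj (f x)).
Proof.
  induction l as [|x l IH]; simpl.
  - unfold Cconj, RtoC; simpl. f_equal; ring.
  - now rewrite Cplus_conj, IH.
Qed.

Lemma sumC_RtoC {A} (l : list A) f : sumC l (fun x => RtoC (f x)) = RtoC (sumR l f).
Proof. induction l as [|x l IH]; simpl; [reflexivity|now rewrite IH, RtoC_plus]. Qed.

Lemma Cmod_sumC {A} (l : list A) f : Cmod (sumC l f) <= sumR l (fun x => Cmod (f x)).
Proof.
  induction l as [|x l IH]; simpl; [rewrite Cmod_0; lra|].
  eapply Rle_trans; [apply Cmod_triangle|]. lra.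
Qed.

Lemma ee_plus x y : ee (x + y) = Cmult (ee x) (ee y).
Proof.
  unfold ee, Cmult; simpl. rewrite Rmult_plus_distr_l, cos_plus, sin_plus. f_equal; ring.
Qed.

Lemma ee_opp x : ee (- x) = Cconj (ee x).
Proof. unfold ee, Cconj; simpl. rewrite Ropp_mult_distr_r_reverse, cos_neg, sin_neg. reflexivity. Qed.

Lemma Cmod_ee x : Cmod (ee x) = 1.
Proof.
  unfold Cmod, ee; cbn [fst snd]. pose proof (sin2_cos2 (2 * PI * x)) as H. unfold Rsqr in H.
  transitivity (sqrt 1); [f_equal; lra|apply sqrt_1].
Qed.

Lemma ee_nat n : ee (INR n) = RtoC 1.
Proof.
  unfold ee, RtoC. replace (2 * PI * INR n) with (0 + 2 * INR n * PI) by ring.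
  now rewrite cos_period, sin_period, cos_0, sin_0.
Qed.

Lemma ee_int z : ee (IZR z) = RtoC 1.
Proof.
  destruct (Z_le_gt_dec 0 z) as [H|H].
  - replace z with (Z.of_nat (Z.to_nat z)) by lia. now rewrite <- INR_IZR_INZ, ee_nat.
  - replace z with (- Z.of_nat (Z.to_nat (- z)))%Z by lia.
    rewrite opp_IZR, <- INR_IZR_INZ, ee_opp, ee_nat. unfold Cconj, RtoC; simpl. f_equal; ring.
Qed.

Definition dirichlet (M : nat) (x : R) : C := sumC (zrange M) (fun j => ee (IZR j * x)).

Lemma dirichlet_period M x n : dirichlet M (x + IZR n) = dirichlet M x.
Proof.
  apply sumC_ext. intros j. rewrite Rmult_plus_distr_l, ee_plus, <- mult_IZR, ee_int. ring.
Qed.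

Lemma dirichlet_opp M x : dirichlet M (- x) = Cconj (dirichlet M x).
Proof.
  unfold dirichlet. rewrite sumC_conj. apply sumC_ext. intros j. rewrite <- ee_opp.
  f_equal; ring.
Qed.

Lemma Cmod_dirichlet_le M x : Cmod (dirichlet M x) <= 2 * INR M + 1.
Proof.
  eapply Rle_trans; [apply Cmod_sumC|].
  rewrite (sumR_ext _ _ (fun _ => 1)) by (intros; apply Cmod_ee).
  rewrite sumR_const. unfold zrange. rewrite length_map, length_seq, plus_INR, mult_INR.
  simpl. lra.
Qed.

Lemma dirichlet_telescope M x :
  Cmult (Cminus (ee x) (RtoC 1)) (dirichlet M x) =
  Cminus (ee ((INR M + 1) * x)) (ee (- INR M * x)).
Proof.
  unfold dirichlet, zrange. rewrite sumC_map.
  replace ((INR M + 1) * x) with ((INR (2 * M + 1) - INR M) * x)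
    by (rewrite plus_INR, mult_INR; simpl; ring).
  generalize (2 * M + 1)%nat as n. induction n as [|n IH].
  - simpl. replace ((0 - INR M) * x) with (- INR M * x) by ring. ring.
  - rewrite seq_S, sumC_app, Cmult_plus_distr_l, IH. simpl.
    rewrite minus_IZR, <- !INR_IZR_INZ.
    (* The match is [INR (S n)] as unfolded by [simpl]. *)
    replace ((match n with O => 1 | S _ => INR n + 1 end - INR M) * x)
      with (x + (INR n - INR M) * x) by (destruct n; simpl; ring).
    rewrite ee_plus. ring.
Qed.

(** The Taylor bound x - x^3 / 6 <= sin x suffices, since x^2 <= 4. *)
Lemma sin_ge_third x : 0 <= x <= 2 -> x / 3 <= sin x.
Proof.
  intros H. destruct (pre_sin_bound x 0) as [K _]; [lra|lra|].
  unfold sin_approx, sin_term in K. simpl in K. nra.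
Qed.

(** |e(d) - 1| = 2 |sin (pi d)|, and pi |d| <= 2 brings [sin_ge_third] into play; pi > 3 absorbs the
    third. *)
Lemma Cmod_ee_minus1 d : Rabs d <= 1 / 2 -> 2 * Rabs d <= Cmod (Cminus (ee d) (RtoC 1)).
Proof.
  intros Hd.
  assert (E : Cmod (Cminus (ee d) (RtoC 1)) ^ 2 = (2 * sin (PI * d)) ^ 2).
  { rewrite Cmod2_alt. unfold ee, Re, Im; simpl.
    replace (2 * PI * d) with (2 * (PI * d)) by ring. rewrite cos_2a, sin_2a.
    pose proof (sin2_cos2 (PI * d)) as K. unfold Rsqr in K.
    set (s := sin (PI * d)) in *. set (c := cos (PI * d)) in *.
    replace (c * c) with (1 - s * s) by lra. nra. }
  assert (K : 2 * Rabs d <= 2 * sin (PI * Rabs d)).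
  { pose proof PI2_3_2. pose proof PI_4. pose proof (Rabs_pos d).
    assert (PI * Rabs d / 3 <= sin (PI * Rabs d)) by (apply sin_ge_third; split; nra).
    nra. }
  assert (E2 : (2 * sin (PI * d)) ^ 2 = (2 * sin (PI * Rabs d)) ^ 2).
  { unfold Rabs. destruct (Rcase_abs d); [|reflexivity].
    replace (PI * - d) with (- (PI * d)) by ring. rewrite sin_neg. ring. }
  rewrite E2 in E. pose proof (Rabs_pos d). pose proof (Cmod_ge_0 (Cminus (ee d) (RtoC 1))).
  nra.
Qed.

Lemma Cmod_dirichlet_decay M d : Rabs d <= 1 / 2 -> Rabs d * Cmod (dirichlet M d) <= 1.
Proof.
  intros Hd. pose proof (Cmod_ee_minus1 d Hd) as K.
  pose proof (f_equal Cmod (dirichlet_telescope M d)) as E. rewrite Cmod_mult in E.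
  assert (Cmod (Cminus (ee ((INR M + 1) * d)) (ee (- INR M * d))) <= 2).
  { eapply Rle_trans; [apply Cmod_triangle|]. rewrite Cmod_opp, !Cmod_ee. lra. }
  pose proof (Cmod_ge_0 (dirichlet M d)). nra.
Qed.

(** Absolute value of a de la Vallee Poussin type kernel: the product of the two Dirichlet kernels
    has all Fourier coefficients on [-M, M] equal to 2 M + 1. Having two factors, it decays like the
    inverse square of the distance to the nearest integer and so is summable over cells. *)
Definition kernel (M : nat) (x : R) : R := Cmod (dirichlet (2 * M) x) * Cmod (dirichlet M x).
(** The representative of x modulo 1 in [-1/2, 1/2) is located among intervals of length 1 / W. *)
Definition cell (W x : R) : Z := Int_part (W * (x - IZR (Int_part (x + 1 / 2)))).
Definition cell_weight (i : Z) : R := 8 / (1 + IZR i ^ 2).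

Lemma kernel_opp M x : kernel M (- x) = kernel M x.
Proof. unfold kernel. now rewrite !dirichlet_opp, !Cmod_conj. Qed.

Lemma kernel_ge0 M x : 0 <= kernel M x.
Proof. apply Rmult_le_pos; apply Cmod_ge_0. Qed.

Lemma cell_weight_ge0 i : 0 <= cell_weight i.
Proof. apply Rlt_le, Rdiv_lt_0_compat; nra. Qed.

(** Away from i = -1 and i = 0 the cell gives |y| >= |i| / 2, so the decay y^2 k <= 1 controls i^2
    k; in the two central cells k <= 2 is enough. *)
Lemma cell_weight_bound (k y : R) (i : Z) : IZR i <= y -> y < IZR i + 1 ->
  k <= 2 -> y ^ 2 * k <= 1 -> 0 <= k -> k <= cell_weight i.
Proof.
  intros H1 H2 Hk Hy Hk0. unfold cell_weight. rewrite <- Rle_div_r by nra.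
  destruct (Z_le_gt_dec i (-2)) as [L|L].
  - apply IZR_le in L. assert (IZR i ^ 2 <= 4 * y ^ 2) by nra. nra.
  - destruct (Z_le_gt_dec i 0) as [L2|L2].
    + assert (- 1 <= IZR i <= 0) by (split; apply IZR_le; lia). nra.
    + assert (1 <= IZR i) by (apply IZR_le; lia). assert (IZR i ^ 2 <= y ^ 2) by nra. nra.
Qed.

(** After division by W^2 the kernel is at most 2 by the trivial bounds 4 M + 1 <= 2 W and 2 M + 1 =
    W, and at most 1 / (W d)^2 by the decay of both factors, d being x reduced modulo 1. *)
Lemma kernel_le M x : let W := 2 * INR M + 1 in kernel M x <= W ^ 2 * cell_weight (cell W x).
Proof.
  intros W. pose proof (pos_INR M). assert (HW : 1 <= W) by (unfold W; lra).
  unfold cell. set (n := Int_part (x + 1 / 2)). set (d := x - IZR n).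
  destruct (base_Int_part (x + 1 / 2)) as [N1 N2]; fold n in N1, N2.
  assert (Hd : Rabs d <= 1 / 2) by (apply Rabs_le; unfold d; lra).
  assert (E : forall m, dirichlet m x = dirichlet m d).
  { intros m. rewrite <- (dirichlet_period m d n). f_equal. unfold d; ring. }
  unfold kernel. rewrite !E.
  pose proof (Cmod_dirichlet_le (2 * M) d) as A1. pose proof (Cmod_dirichlet_le M d) as A2.
  pose proof (Cmod_dirichlet_decay (2 * M) d Hd) as A3. pose proof (Cmod_dirichlet_decay M d Hd) as A4.
  pose proof (Cmod_ge_0 (dirichlet (2 * M) d)) as A5. pose proof (Cmod_ge_0 (dirichlet M d)) as A6.
  rewrite mult_INR in A1. simpl (INR 2) in A1.
  set (u := Cmod (dirichlet (2 * M) d)) in *. set (v := Cmod (dirichlet M d)) in *.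
  destruct (base_Int_part (W * d)) as [C1 C2].
  assert (HW2 : 0 < W ^ 2) by nra.
  apply Rmult_le_reg_l with (/ W ^ 2); [now apply Rinv_0_lt_compat|].
  rewrite <- (Rmult_assoc (/ W ^ 2) (W ^ 2)), Rinv_l, Rmult_1_l by lra.
  pose proof (Rabs_pos d). assert (Ed : Rabs d ^ 2 = d ^ 2) by apply pow2_abs.
  assert (0 <= / W ^ 2) by (apply Rlt_le, Rinv_0_lt_compat; lra).
  assert (0 <= u * v) by (apply Rmult_le_pos; lra).
  apply (cell_weight_bound _ (W * d)); [lra|lra| | |].
  - apply Rmult_le_reg_l with (W ^ 2); [lra|].
    rewrite <- (Rmult_assoc (W ^ 2) (/ W ^ 2)), Rinv_r, Rmult_1_l by lra.
    assert (u <= 2 * W) by (unfold W; lra). assert (v <= W) by (unfold W; lra).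
    apply Rle_trans with ((2 * W) * W); [|lra]. apply Rmult_le_compat; lra.
  - replace ((W * d) ^ 2 * (/ W ^ 2 * (u * v))) with (d ^ 2 * (u * v)) by (field; lra).
    rewrite <- Ed. replace (Rabs d ^ 2 * (u * v)) with ((Rabs d * u) * (Rabs d * v)) by ring.
    replace 1 with (1 * 1) by ring. apply Rmult_le_compat; try lra; apply Rmult_le_pos; lra.
  - apply Rmult_le_pos; lra.
Qed.

Lemma cell_spec W x : 0 < W -> exists n : Z,
  IZR (cell W x) / W <= x + IZR n <= IZR (cell W x) / W + 1 / W.
Proof.
  intros HW. exists (- Int_part (x + 1 / 2))%Z. rewrite opp_IZR. unfold cell.
  set (d := x - IZR (Int_part (x + 1 / 2))). destruct (base_Int_part (W * d)) as [C1 C2].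
  replace (x + - IZR (Int_part (x + 1 / 2))) with d by (unfold d; ring).
  split.
  - rewrite Rle_div_l by lra; lra.
  - rewrite <- Rdiv_plus_distr. rewrite <- Rle_div_r by lra; lra.
Qed.

Lemma cell_in_zrange (W : nat) x : In (cell (INR W) x) (zrange W).
Proof.
  apply in_zrange. unfold cell. pose proof (pos_INR W).
  destruct (base_Int_part (x + 1 / 2)) as [N1 N2].
  set (d := x - IZR (Int_part (x + 1 / 2))).
  assert (- (1 / 2) <= d <= 1 / 2) by (unfold d; lra).
  destruct (base_Int_part (INR W * d)) as [C1 C2].
  rewrite INR_IZR_INZ in *.
  split.
  - assert (- Z.of_nat W - 1 < Int_part (IZR (Z.of_nat W) * d))%Z; [|lia].
    apply lt_IZR. rewrite minus_IZR, opp_IZR. nra.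
  - apply le_IZR. nra.
Qed.

(* [25 t / (1 + |t|)] increases by at least [cell_weight i] from [i] to [i + 1]. *)
Lemma cell_weight_sum M : sumR (zrange M) cell_weight <= 50.
Proof.
  set (phi := fun t : R => 25 * (t / (1 + Rabs t))).
  assert (B : forall t, -25 <= phi t <= 25).
  { intros t. unfold phi. pose proof (Rabs_pos t).
    assert (-1 <= t / (1 + Rabs t) <= 1); [|lra].
    pose proof (Rle_abs t). pose proof (Rle_abs (- t)). rewrite Rabs_Ropp in H1.
    split; [rewrite <- Rle_div_r by lra|rewrite Rle_div_l by lra]; lra. }
  assert (D : forall i : Z, cell_weight i <= phi (IZR i + 1) - phi (IZR i)).
  { intros i. unfold cell_weight, phi. destruct (Z_le_gt_dec 0 i) as [L|L].
    - apply IZR_le in L. rewrite !Rabs_pos_eq by lra. set (y := IZR i) in *.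
      replace (25 * ((y + 1) / (1 + (y + 1))) - 25 * (y / (1 + y))) with (25 / ((1 + y) * (2 + y)))
        by (field; lra).
      rewrite <- Rle_div_r by nra.
      replace (8 / (1 + y ^ 2) * ((1 + y) * (2 + y))) with (8 * ((1 + y) * (2 + y)) / (1 + y ^ 2))
        by (field; nra).
      (* The claim is 17 y^2 - 24 y + 9 >= 0, and 17 times this polynomial equals (17 y - 12)^2 +
         9. *)
      rewrite Rle_div_l by nra. pose proof (pow2_ge_0 (17 * y - 12)). nra.
    - assert (IZR i <= -1) by (apply IZR_le; lia).
      rewrite !Rabs_left1 by lra. set (y := IZR i) in *.
      replace (25 * ((y + 1) / (1 + - (y + 1))) - 25 * (y / (1 + - y))) with (25 / ((1 - y) * (- y)))
        by (field; lra).
      rewrite <- Rle_div_r by nra.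
      replace (8 / (1 + y ^ 2) * ((1 - y) * - y)) with (8 * ((1 - y) * - y) / (1 + y ^ 2))
        by (field; nra).
      rewrite Rle_div_l by nra. pose proof (pow2_ge_0 (17 * y - 12)). nra. }
  unfold zrange. rewrite sumR_map.
  assert (T : forall n, sumR (seq 0 n) (fun k => cell_weight (Z.of_nat k - Z.of_nat M))
              <= phi (INR n - INR M) - phi (- INR M)).
  { induction n as [|n IH].
    - simpl. replace (0 - INR M) with (- INR M) by ring. lra.
    - rewrite seq_S, sumR_app, S_INR. simpl.
      pose proof (D (Z.of_nat n - Z.of_nat M)%Z) as K.
      rewrite minus_IZR, <- !INR_IZR_INZ in K.
      replace (INR n + 1 - INR M) with (INR n - INR M + 1) by ring. lra. }
  eapply Rle_trans; [apply T|]. pose proof (B (INR (2 * M + 1) - INR M)).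
  pose proof (B (- INR M)). lra.
Qed.

(** * The two-dimensional large sieve *)

Lemma NoDup_list_prod {A B} (l : list A) (l' : list B) :
  NoDup l -> NoDup l' -> NoDup (list_prod l l').
Proof.
  intros Hl Hl'. induction Hl as [|x l Hx Hl IH]; simpl; [constructor|].
  apply NoDup_app.
  - apply FinFun.Injective_map_NoDup; [|assumption]. intros y z E. congruence.
  - assumption.
  - intros [u v] H1 H2. apply in_map_iff in H1. destruct H1 as (y & E & _).
    injection E as -> _. apply in_prod_iff in H2. tauto.
Qed.

Lemma NoDup_gbox M : NoDup (gbox M).
Proof.
  assert (NoDup (zrange M)).
  { unfold zrange. apply FinFun.Injective_map_NoDup; [|apply seq_NoDup].
    intros i j E. lia. }
  now apply NoDup_list_prod.
Qed.

Lemma length_gbox M : length (gbox M) = ((2 * M + 1) * (2 * M + 1))%nat.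
Proof.
  transitivity (length (zrange M) * length (zrange M))%nat; [apply length_prod|].
  unfold zrange. now rewrite length_map, length_seq.
Qed.

Definition chi (n : GI) (x y : R) : C := ee (IZR (fst n) * x + IZR (snd n) * y).

Lemma chi_sub n n' x y : chi (gsub n n') x y = Cmult (chi n x y) (Cconj (chi n' x y)).
Proof.
  unfold chi. rewrite <- ee_opp, <- ee_plus. f_equal. destruct n, n'; simpl.
  rewrite !minus_IZR. ring.
Qed.

Lemma chi_diff n x y x' y' :
  chi n (x - x') (y - y') = Cmult (chi n x y) (Cconj (chi n x' y')).
Proof. unfold chi. rewrite <- ee_opp, <- ee_plus. f_equal. ring. Qed.

Lemma sumC_chi_gbox M x y :
  sumC (gbox M) (fun n => chi n x y) = Cmult (dirichlet M x) (dirichlet M y).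
Proof.
  etransitivity; [exact (sumC_list_prod (zrange M) (zrange M) (fun n => chi n x y))|].
  unfold dirichlet at 1.
  rewrite Cmult_comm, <- sumC_scal. apply sumC_ext. intros i.
  rewrite Cmult_comm. unfold dirichlet. rewrite <- sumC_scal. apply sumC_ext. intros j.
  unfold chi; simpl. apply ee_plus.
Qed.

(* Every [n] in [gbox M] is [j - j'] with [j] in [gbox (2 * M)], for each [j'] in [gbox M]. *)
Lemma sum_over_differences (N M : nat) (phi : GI -> R) :
  (forall n, 0 <= phi n) -> (forall n, In n (gdisc N) -> In n (gbox M)) ->
  (2 * INR M + 1) ^ 2 * sumR (gdisc N) phi <=
  sumR (gbox M) (fun j' => sumR (gbox (2 * M)) (fun j => phi (gsub j j'))).
Proof.
  intros Hphi HN.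
  replace ((2 * INR M + 1) ^ 2) with (INR (length (gbox M))).
  2:{ rewrite length_gbox, mult_INR, plus_INR, mult_INR. simpl. ring. }
  rewrite <- sumR_const. apply sumR_le. intros j' Hj'.
  rewrite <- (sumR_map (fun j => gsub j j') (gbox (2 * M)) phi).
  apply sumR_incl; [apply NoDup_filter, NoDup_gbox| |assumption].
  intros n Hn. apply in_map_iff. exists (gadd n j'). split; [ring|].
  apply HN in Hn. destruct n as [n1 n2], j' as [j1 j2]. unfold gbox in *.
  apply in_prod_iff in Hn, Hj'. apply in_prod_iff. rewrite !in_zrange in *. simpl. lia.
Qed.

(** Expanding the square, the character at j - j' splits into one factor in j and one in j'. Both
    sums run over full boxes, so each is a product of two Dirichlet kernels; absolute values are
    taken only at the end. *)
Lemma double_sum_kernel {A} (P : list A) (x y : A -> R) (c : A -> C) M :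
  sumR (gbox M) (fun j' => sumR (gbox (2 * M)) (fun j =>
    Cmod (sumC P (fun p => Cmult (c p) (chi (gsub j j') (x p) (y p)))) ^ 2))
  <= sumR P (fun p => sumR P (fun s => Cmod (c p) * Cmod (c s) *
       (kernel M (x p - x s) * kernel M (y p - y s)))).
Proof.
  set (D := fun n : GI => sumC P (fun p => Cmult (c p) (chi n (x p) (y p)))).
  set (T := sumR (gbox M) (fun j' => sumR (gbox (2 * M)) (fun j => Cmod (D (gsub j j')) ^ 2))).
  assert (E : RtoC T = sumC P (fun p => sumC P (fun s => Cmult (Cmult (c p) (Cconj (c s)))
     (Cmult (sumC (gbox (2 * M)) (fun j => chi j (x p - x s) (y p - y s)))
        (Cconj (sumC (gbox M) (fun j => chi j (x p - x s) (y p - y s)))))))).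
  { unfold T. rewrite <- sumC_RtoC.
    transitivity (sumC (gbox M) (fun j' => sumC (gbox (2 * M)) (fun j =>
       sumC P (fun p => sumC P (fun s =>
         Cmult (Cmult (c p) (Cconj (c s))) (Cmult (chi j (x p - x s) (y p - y s))
            (Cconj (chi j' (x p - x s) (y p - y s))))))))).
    - apply sumC_ext. intros j'. rewrite <- sumC_RtoC. apply sumC_ext. intros j.
      rewrite Cmod2_conj. unfold D at 1. rewrite Cmult_comm, <- sumC_scal.
      apply sumC_ext. intros p. unfold D. rewrite sumC_conj, Cmult_comm, <- sumC_scal.
      apply sumC_ext. intros s. rewrite !chi_diff, !chi_sub, !Cmult_conj, !Cconj_conj. ring.
    - rewrite (sumC_ext (gbox M) _ (fun j' => sumC P (fun p => sumC P (fun s =>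
         Cmult (Cmult (c p) (Cconj (c s))) (Cmult (sumC (gbox (2 * M)) (fun j => chi j (x p - x s) (y p - y s)))
            (Cconj (chi j' (x p - x s) (y p - y s)))))))).
      2:{ intros j'. rewrite sumC_swap. apply sumC_ext. intros p.
          rewrite sumC_swap. apply sumC_ext. intros s.
          rewrite sumC_scal. f_equal. rewrite Cmult_comm, <- sumC_scal.
          apply sumC_ext. intros j. ring. }
      rewrite sumC_swap. apply sumC_ext. intros p.
      rewrite sumC_swap. apply sumC_ext. intros s.
      rewrite sumC_scal. f_equal. rewrite sumC_scal. f_equal. now rewrite sumC_conj. }
  change (T <= sumR P (fun p => sumR P (fun s => Cmod (c p) * Cmod (c s) *
       (kernel M (x p - x s) * kernel M (y p - y s))))).
  apply Rle_trans with (Cmod (RtoC T)); [rewrite Cmod_R; apply Rle_abs|].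
  rewrite E. eapply Rle_trans; [apply Cmod_sumC|]. apply sumR_le. intros p _.
  eapply Rle_trans; [apply Cmod_sumC|]. apply sumR_le. intros s _.
  rewrite !Cmod_mult, !Cmod_conj, !sumC_chi_gbox, !Cmod_mult. unfold kernel. right. ring.
Qed.

(** Use 2 c_p c_s <= c_p^2 + c_s^2; by the symmetry of k both halves are controlled by the same row
    sums. *)
Lemma schur_test {A} (P : list A) (c : A -> R) (k : A -> A -> R) B :
  (forall p s, 0 <= k p s) -> (forall p s, k p s = k s p) ->
  (forall p, In p P -> sumR P (k p) <= B) ->
  sumR P (fun p => sumR P (fun s => c p * c s * k p s)) <= B * sumR P (fun p => c p ^ 2).
Proof.
  intros Hk Hs HB.
  apply Rle_trans with (sumR P (fun p => sumR P (fun s => c p ^ 2 / 2 * k p s))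
                        + sumR P (fun p => sumR P (fun s => c s ^ 2 / 2 * k p s))).
  - rewrite <- sumR_plus. apply sumR_le. intros p _. rewrite <- sumR_plus. apply sumR_le. intros s _.
    pose proof (Hk p s). pose proof (pow2_ge_0 (c p - c s)).
    replace (c p ^ 2 / 2 * k p s + c s ^ 2 / 2 * k p s)
      with (c p * c s * k p s + (c p - c s) ^ 2 * k p s / 2) by field.
    nra.
  - rewrite (sumR_swap P P (fun p s => c s ^ 2 / 2 * k p s)).
    rewrite <- (sumR_ext P (fun p => sumR P (fun s => c p ^ 2 / 2 * k p s)) (fun y => sumR P (fun x => c y ^ 2 / 2 * k x y)))
      by (intros; apply sumR_ext; intros; rewrite Hs; reflexivity).
    apply Rle_trans with (2 * sumR P (fun p => c p ^ 2 / 2 * B)).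
    + assert (sumR P (fun p => sumR P (fun s => c p ^ 2 / 2 * k p s)) <= sumR P (fun p => c p ^ 2 / 2 * B)); [|lra].
      apply sumR_le. intros p Hp. rewrite sumR_scal. apply Rmult_le_compat_l; [|now apply HB].
      pose proof (pow2_ge_0 (c p)). lra.
    + rewrite <- sumR_scal, <- sumR_scal. right. apply sumR_ext. intros p _. field.
Qed.

(** The shifts m, n make this a condition modulo Z^2, as it must be: the residues a mod q may be
    represented arbitrarily. *)
Definition in_cell (W u v x y : R) : Prop :=
  exists m n : Z, u <= x + IZR m <= u + 1 / W /\ v <= y + IZR n <= v + 1 / W.

(** Sort the points by their cell relative to (x0, y0). A cell holds at most K points, and the
    weights of all cells sum to at most 50 in each coordinate, whence 2500. *)
Lemma kernel_row_sum {A} (P : list A) (x y : A -> R) M K x0 y0 :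
  let W := 2 * INR M + 1 in
  (forall u v, INR (countP P (fun s => in_cell W u v (x s) (y s))) <= K) ->
  sumR P (fun s => kernel M (x s - x0) * kernel M (y s - y0)) <= 2500 * W ^ 4 * K.
Proof.
  intros W HK. pose proof (pos_INR M). assert (HW : 1 <= W) by (unfold W; lra).
  assert (EW : W = INR (2 * M + 1)) by (unfold W; rewrite plus_INR, mult_INR; simpl; ring).
  assert (K0 : 0 <= K) by (eapply Rle_trans; [apply pos_INR|apply (HK 0 0)]).
  set (h := fun ij => cell_weight (fst ij) * cell_weight (snd ij)).
  set (f := fun s => (cell W (x s - x0), cell W (y s - y0))).
  assert (Hh : forall ij, 0 <= h ij) by (intros; apply Rmult_le_pos; apply cell_weight_ge0).
  apply Rle_trans with (sumR P (fun s => W ^ 4 * h (f s))).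
  { apply sumR_le. intros s _. unfold h, f; simpl fst; simpl snd.
    pose proof (kernel_le M (x s - x0)) as K1. pose proof (kernel_le M (y s - y0)) as K2.
    cbv zeta in K1, K2. fold W in K1, K2.
    replace (W ^ 4 * (cell_weight (cell W (x s - x0)) * cell_weight (cell W (y s - y0))))
      with ((W ^ 2 * cell_weight (cell W (x s - x0))) * (W ^ 2 * cell_weight (cell W (y s - y0)))) by ring.
    apply Rmult_le_compat; try apply kernel_ge0; assumption. }
  rewrite sumR_scal.
  assert (HW4 : 0 <= W ^ 4) by (apply pow_le; lra).
  replace (2500 * W ^ 4 * K) with (W ^ 4 * (2500 * K)) by ring.
  apply Rmult_le_compat_l; [assumption|].
  eapply Rle_trans; [apply (sumR_fiber (fun s b => f s = b) P (list_prod (zrange (2 * M + 1)) (zrange (2 * M + 1))))|].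
  { intros s _. exists (f s). split; [|reflexivity]. apply in_prod; rewrite EW; apply cell_in_zrange. }
  { intros; apply Hh. }
  apply Rle_trans with (sumR (list_prod (zrange (2 * M + 1)) (zrange (2 * M + 1))) (fun b => K * h b)).
  - apply sumR_le. intros b _.
    rewrite (sumR_ext _ _ (fun _ => h b)).
    2:{ intros s Hs. apply filter_In in Hs. destruct Hs as [_ Hs]. apply (proj1 (dec_true _)) in Hs. now rewrite Hs. }
    rewrite sumR_const. apply Rmult_le_compat_r; [apply Hh|].
    eapply Rle_trans; [|apply (HK (x0 + IZR (fst b) / W) (y0 + IZR (snd b) / W))].
    unfold countP. rewrite <- (Rmult_1_r (INR _)), <- (Rmult_1_r (INR (length (filter (fun s => dec (in_cell _ _ _ _ _)) _)))).
    rewrite <- !sumR_const, !sumR_filter. apply sumR_le. intros s _.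
    destruct (dec (f s = b)) eqn:E.
    + apply (proj1 (dec_true _)) in E.
      replace (dec _) with true; [lra|]. symmetry. apply (proj2 (dec_true _)).
      destruct (cell_spec W (x s - x0)) as [m Hm]; [lra|].
      destruct (cell_spec W (y s - y0)) as [n Hn]; [lra|].
      exists m, n. rewrite <- E. unfold f; simpl fst; simpl snd. split; lra.
    + destruct (dec (in_cell _ _ _ _ _)); lra.
  - rewrite sumR_scal, Rmult_comm. apply Rmult_le_compat_r; [assumption|].
    rewrite sumR_list_prod. unfold h; simpl fst; simpl snd.
    rewrite (sumR_ext _ _ (fun i => sumR (zrange (2 * M + 1)) cell_weight * cell_weight i))
      by (intros; rewrite sumR_scal; ring).
    rewrite sumR_scal. pose proof (cell_weight_sum (2 * M + 1)).
    pose proof (sumR_nonneg (zrange (2 * M + 1)) cell_weight (fun i _ => cell_weight_ge0 i)).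
    nra.
Qed.

(** With [T p] the exponential sum at p, the left side [V] equals the sum of a_n [D n], where [D] is
    the dual sum with coefficients conj ([T p]). The kernel estimates bound the square sum of [D] by
    [B * V]. *)
Lemma large_sieve {A} (P : list A) (x y : A -> R) (a : GI -> C) (N M : nat) K :
  let W := 2 * INR M + 1 in
  (forall n, In n (gdisc N) -> In n (gbox M)) -> 0 < K ->
  (forall u v, INR (countP P (fun s => in_cell W u v (x s) (y s))) <= K) ->
  sumR P (fun p => Cmod (sumC (gdisc N) (fun n => Cmult (a n) (chi n (x p) (y p)))) ^ 2)
  <= 2500 * W ^ 2 * K * sumR (gdisc N) (fun n => Cmod (a n) ^ 2).
Proof.
  intros W HN HK HC. pose proof (pos_INR M). assert (HW : 1 <= W) by (unfold W; lra).
  set (T := fun p => sumC (gdisc N) (fun n => Cmult (a n) (chi n (x p) (y p)))).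
  set (V := sumR P (fun p => Cmod (T p) ^ 2)).
  set (D := fun n => sumC P (fun p => Cmult (Cconj (T p)) (chi n (x p) (y p)))).
  set (B := 2500 * W ^ 2 * K).
  set (Z := sumR (gdisc N) (fun n => Cmod (a n) ^ 2)).
  assert (HW2 : 1 <= W ^ 2) by nra.
  assert (HB : 0 < B) by (unfold B; nra).
  change (V <= B * Z).
  assert (HD : sumR (gdisc N) (fun n => Cmod (D n) ^ 2) <= B * V).
  (* [sum_over_differences] gains W^2 on the left and the Schur test costs 2500 W^4 K on the right;
     the quotient is [B]. *)
  { apply Rmult_le_reg_l with (W ^ 2); [lra|].
    eapply Rle_trans; [apply (sum_over_differences N M (fun n => Cmod (D n) ^ 2)); [intros; apply pow2_ge_0|assumption]|].
    eapply Rle_trans; [apply double_sum_kernel|].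
    eapply Rle_trans; [apply (schur_test P (fun p => Cmod (Cconj (T p)))
       (fun p s => kernel M (x p - x s) * kernel M (y p - y s)) (2500 * W ^ 4 * K))|].
    - intros; apply Rmult_le_pos; apply kernel_ge0.
    - intros p s. rewrite <- (kernel_opp M (x p - x s)), <- (kernel_opp M (y p - y s)).
      f_equal; f_equal; ring.
    - intros p _. rewrite (sumR_ext P _ (fun s => kernel M (x s - x p) * kernel M (y s - y p))).
      + now apply kernel_row_sum.
      + intros s _. rewrite <- (kernel_opp M (x p - x s)), <- (kernel_opp M (y p - y s)).
        f_equal; f_equal; ring.
    - right. unfold B, V. rewrite (sumR_ext P _ (fun p => Cmod (T p) ^ 2)) by (intros; now rewrite Cmod_conj).
      ring. }
  assert (HV : RtoC V = sumC (gdisc N) (fun n => Cmult (a n) (D n))).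
  { unfold V. rewrite <- sumC_RtoC.
    transitivity (sumC P (fun p => sumC (gdisc N) (fun n =>
       Cmult (Cconj (T p)) (Cmult (a n) (chi n (x p) (y p)))))).
    - apply sumC_ext. intros p. rewrite Cmod2_conj, sumC_scal, Cmult_comm. reflexivity.
    - rewrite sumC_swap. apply sumC_ext. intros n. unfold D. rewrite <- sumC_scal.
      apply sumC_ext. intros p. ring. }
  (* AM-GM with weight [B] in place of Cauchy-Schwarz: half of [V] is then absorbed on the left. *)
  assert (HV2 : V <= sumR (gdisc N) (fun n => B / 2 * Cmod (a n) ^ 2 + / (2 * B) * Cmod (D n) ^ 2)).
  { apply Rle_trans with (Cmod (RtoC V)); [rewrite Cmod_R; apply Rle_abs|].
    rewrite HV. eapply Rle_trans; [apply Cmod_sumC|]. apply sumR_le. intros n _.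
    rewrite Cmod_mult. set (u := Cmod (a n)). set (v := Cmod (D n)).
    apply Rmult_le_reg_l with (2 * B); [lra|].
    replace (2 * B * (B / 2 * u ^ 2 + / (2 * B) * v ^ 2)) with ((B * u) ^ 2 + v ^ 2) by (field; lra).
    pose proof (pow2_ge_0 (B * u - v)). nra. }
  rewrite sumR_plus, !sumR_scal in HV2. fold Z in HV2.
  assert (/ (2 * B) * sumR (gdisc N) (fun n => Cmod (D n) ^ 2) <= V / 2).
  { replace (V / 2) with (/ (2 * B) * (B * V)) by (field; lra).
    apply Rmult_le_compat_l; [|assumption]. apply Rlt_le, Rinv_0_lt_compat; lra. }
  lra.
Qed.

(** * Dirichlet approximation by Gaussian rationals *)

Lemma toC_mul a b : toC (gmul a b) = Cmult (toC a) (toC b).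
Proof.
  unfold toC, Cmult; simpl. rewrite minus_IZR, plus_IZR, !mult_IZR. reflexivity.
Qed.

Lemma toC_sub a b : toC (gsub a b) = Cminus (toC a) (toC b).
Proof.
  unfold toC, Cminus, Cplus, Copp; simpl. rewrite !minus_IZR. f_equal; ring.
Qed.

Lemma gabs_Cmod q : gabs q = Cmod (toC q).
Proof.
  unfold gabs, Cmod, toC, gnorm; simpl. f_equal. rewrite plus_IZR, !mult_IZR. ring.
Qed.

Lemma gabs_mul a b : gabs (gmul a b) = gabs a * gabs b.
Proof. now rewrite !gabs_Cmod, toC_mul, Cmod_mult. Qed.

Lemma gabs_sqr q : gabs q ^ 2 = IZR (gnorm q).
Proof. unfold gabs. apply pow2_sqrt. apply IZR_le, gnorm_ge0. Qed.

Lemma gabs_ge0 q : 0 <= gabs q.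
Proof. apply sqrt_pos. Qed.

Lemma gabs_ge1 q : q <> g0 -> 1 <= gabs q.
Proof.
  intros H. unfold gabs. rewrite <- sqrt_1 at 1. apply sqrt_le_1_alt. apply IZR_le.
  now apply gnorm_pos.
Qed.

Lemma in_gbox_gabs M q : gabs q < INR M + 1 -> In q (gbox M).
Proof.
  intros H. apply in_gbox, lt_IZR. rewrite <- gabs_sqr, mult_IZR, plus_IZR, <- INR_IZR_INZ.
  pose proof (gabs_ge0 q). nra.
Qed.

(** Leaving out 0 makes the bound purely quadratic: for Y < 1 nothing remains, and for Y >= 1 the
    box of half-side M = floor Y has (2 M + 1)^2 <= 9 Y^2 points. *)
Lemma lattice_disc Y : 0 <= Y -> exists l,
  (forall g, g <> g0 -> gabs g <= Y -> In g l) /\ INR (length l) <= 9 * Y ^ 2.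
Proof.
  intros HY. destruct (Rlt_le_dec Y 1) as [H|H].
  - exists nil. split; [intros g Hg K; pose proof (gabs_ge1 g Hg); lra|simpl; nra].
  - destruct (nfloor_ex Y HY) as [M HM]. exists (gbox M). split.
    + intros g _ Hg. apply in_gbox_gabs. lra.
    + rewrite length_gbox, mult_INR, plus_INR, mult_INR. simpl. pose proof (pos_INR M). nra.
Qed.

Lemma pigeonhole {A B} (f : A -> B) (l : list A) (l' : list B) :
  NoDup l -> (forall x, In x l -> In (f x) l') -> (length l' < length l)%nat ->
  exists x y, In x l /\ In y l /\ x <> y /\ f x = f y.
Proof.
  intros Hl Hf Hlen. apply NNPP. intros K.
  assert (NoDup (map f l)) as H.
  { apply NoDup_map_NoDup_ForallPairs; [|assumption]. intros x y Hx Hy E.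
    apply NNPP. intros N. apply K. now exists x, y. }
  assert (length (map f l) <= length l')%nat; [|rewrite length_map in *; lia].
  apply NoDup_incl_length; [assumption|]. intros b Hb. apply in_map_iff in Hb.
  destruct Hb as (x & <- & Hx). auto.
Qed.

Lemma Cmod_le_sqr z c : 0 <= c -> fst z ^ 2 + snd z ^ 2 <= c ^ 2 -> Cmod z <= c.
Proof.
  intros Hc H. unfold Cmod. rewrite <- (sqrt_pow2 c) by assumption. now apply sqrt_le_1_alt.
Qed.

Lemma same_cell_close (H : R) f1 f2 : 0 < H -> Int_part (H * f1) = Int_part (H * f2) ->
  (f1 - f2) ^ 2 <= (1 / H) ^ 2.
Proof.
  intros HH E. destruct (base_Int_part (H * f1)) as [A1 A2].
  destruct (base_Int_part (H * f2)) as [B1 B2]. rewrite E in A1, A2.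
  assert (-1 <= H * (f1 - f2) <= 1) by lra.
  apply Rmult_le_reg_l with (H ^ 2); [nra|].
  replace (H ^ 2 * (1 / H) ^ 2) with 1 by (field; lra).
  replace (H ^ 2 * (f1 - f2) ^ 2) with ((H * (f1 - f2)) ^ 2) by ring. nra.
Qed.

Lemma cell_nat_range (H : nat) v : (0 < H)%nat ->
  In (Int_part (INR H * frac_part v)) (map Z.of_nat (seq 0 H)).
Proof.
  intros HH. apply lt_INR in HH. simpl in HH.
  destruct (base_fp v) as [F1 F2].
  destruct (base_Int_part (INR H * frac_part v)) as [A1 A2].
  set (i := Int_part (INR H * frac_part v)) in *.
  assert (-1 < i)%Z by (apply lt_IZR; nra).
  assert (i < Z.of_nat H)%Z by (apply lt_IZR; rewrite <- INR_IZR_INZ; nra).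
  apply in_map_iff. exists (Z.to_nat i). split; [lia|]. apply in_seq. lia.
Qed.

Lemma gdirichlet_pigeonhole (al : C) (T : R) : 4 < T -> exists b r, r <> g0 /\ gabs r <= T /\
  Cmod (Cminus (Cmult (toC r) al) (toC b)) <= 4 / T.
Proof.
  (* There are (H + 1)^2 candidates and H^2 cells of side 1 / H. Two candidates in one cell differ
     by some r with |r| <= sqrt 2 H and error at most sqrt 2 / H. The factor 7/10 lies below 1 /
     sqrt 2, so |r| <= T, and for T > 4 the error is still at most 4 / T. *)
  intros HT. destruct (nfloor_ex (7 / 10 * T)) as [H [H1 H2]]; [lra|].
  assert (HH : 0 < INR H) by lra.
  assert (HH' : (0 < H)%nat) by now apply INR_lt.
  set (toG := fun p : nat * nat => (Z.of_nat (fst p), Z.of_nat (snd p)) : GI).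
  set (w := fun p => Cmult (toC (toG p)) al).
  set (f := fun p => (Int_part (INR H * frac_part (fst (w p))), Int_part (INR H * frac_part (snd (w p))))).
  destruct (pigeonhole f (list_prod (seq 0 (H + 1)) (seq 0 (H + 1)))
              (list_prod (map Z.of_nat (seq 0 H)) (map Z.of_nat (seq 0 H))))
    as (p & p' & Hp & Hp' & Hne & Hf).
  - apply NoDup_list_prod; apply seq_NoDup.
  - intros p _. apply in_prod; now apply cell_nat_range.
  - rewrite !length_prod, !length_map, !length_seq. nia.
  - assert (Hf1 : Int_part (INR H * frac_part (fst (w p))) = Int_part (INR H * frac_part (fst (w p'))))
      by exact (f_equal fst Hf).
    assert (Hf2 : Int_part (INR H * frac_part (snd (w p))) = Int_part (INR H * frac_part (snd (w p'))))
      by exact (f_equal snd Hf).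
    exists ((Int_part (fst (w p)) - Int_part (fst (w p')))%Z,
            (Int_part (snd (w p)) - Int_part (snd (w p')))%Z), (gsub (toG p) (toG p')).
    split; [|split].
    + intros E. apply Hne. destruct p, p'. unfold gsub, toG, g0 in E; simpl in E.
      injection E as E1 E2. f_equal; lia.
    + rewrite gabs_Cmod. apply Cmod_le_sqr; [lra|].
      destruct p as [x y], p' as [x' y']. apply in_prod_iff in Hp, Hp'. rewrite !in_seq in Hp, Hp'.
      unfold toC, gsub, toG; simpl fst; simpl snd. rewrite !minus_IZR, <- !INR_IZR_INZ.
      assert (R : forall u v : nat, (u < H + 1)%nat -> (v < H + 1)%nat -> (INR u - INR v) ^ 2 <= INR H ^ 2).
      { intros u v U V. assert (INR u <= INR H) by (apply le_INR; lia).
        assert (INR v <= INR H) by (apply le_INR; lia).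
        pose proof (pos_INR u). pose proof (pos_INR v). nra. }
      pose proof (R x x' ltac:(lia) ltac:(lia)). pose proof (R y y' ltac:(lia) ltac:(lia)). nra.
    + assert (0 < 4 / T) by (apply Rdiv_lt_0_compat; lra).
      apply Cmod_le_sqr; [lra|].
      rewrite toC_sub. replace (Cmult (Cminus (toC (toG p)) (toC (toG p'))) al) with (Cminus (w p) (w p'))
        by (unfold w; ring).
      pose proof (same_cell_close _ _ _ HH Hf1) as C1. pose proof (same_cell_close _ _ _ HH Hf2) as C2.
      unfold frac_part in C1, C2.
      clear Hf1 Hf2. revert C1 C2. generalize (w p) (w p'). intros [x1 y1] [x2 y2].
      unfold Cminus, Cplus, Copp, toC; simpl fst; simpl snd. rewrite !minus_IZR. intros C1 C2.
      assert (HHT : 2 * (1 / INR H) ^ 2 <= (4 / T) ^ 2).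
      { apply Rmult_le_reg_l with (INR H ^ 2 * T ^ 2); [apply Rmult_lt_0_compat; apply pow_lt; lra|].
        replace (INR H ^ 2 * T ^ 2 * (2 * (1 / INR H) ^ 2)) with (2 * T ^ 2) by (field; lra).
        replace (INR H ^ 2 * T ^ 2 * (4 / T) ^ 2) with (16 * INR H ^ 2) by (field; lra). nra. }
      eapply Rle_trans; [|exact HHT].
      replace (x1 + - x2 + - (IZR (Int_part x1) - IZR (Int_part x2)))
        with (x1 - IZR (Int_part x1) - (x2 - IZR (Int_part x2))) by ring.
      replace (y1 + - y2 + - (IZR (Int_part y1) - IZR (Int_part y2)))
        with (y1 - IZR (Int_part y1) - (y2 - IZR (Int_part y2))) by ring.
      lra.
Qed.

(** Cancelling the gcd of b and r decreases neither precision nor the room below T: both |r| and the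
    error are divided by |t| >= 1. *)
Lemma gdirichlet (al : C) (T : R) : 1 <= T -> exists b r, r <> g0 /\ gabs r <= T /\
  Cmod (Cminus (Cmult (toC r) al) (toC b)) <= 4 / T /\ gcoprime r b.
Proof.
  intros HT.
  assert (exists b r, r <> g0 /\ gabs r <= T /\
    Cmod (Cminus (Cmult (toC r) al) (toC b)) <= 4 / T) as (b & r & Hr & HrT & Hb).
  { destruct (Rle_lt_dec T 4) as [H|H]; [|now apply gdirichlet_pigeonhole].
    (* For T <= 4 the nearest Gaussian integer will do, as the allowed error 4 / T is at least 1. *)
    exists (Int_part (fst al + 1 / 2), Int_part (snd al + 1 / 2)), g1.
    split; [discriminate|]. split.
    - unfold gabs, gnorm; simpl. rewrite sqrt_1. assumption.
    - assert (1 <= 4 / T) by (rewrite <- Rle_div_r; lra).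
      eapply Rle_trans; [|eassumption]. apply Cmod_le_sqr; [lra|].
      destruct (base_Int_part (fst al + 1 / 2)). destruct (base_Int_part (snd al + 1 / 2)).
      unfold Cminus, Cplus, Copp, Cmult, toC, g1; simpl fst; simpl snd.
      set (i := IZR (Int_part (fst al + 1 / 2))) in *. set (j := IZR (Int_part (snd al + 1 / 2))) in *.
      assert (-1/2 <= 1 * fst al - 0 * snd al + - i <= 1/2) by lra.
      assert (-1/2 <= 1 * snd al + 0 * fst al + - j <= 1/2) by lra. nra. }
  destruct (gcd_split b r Hr) as (t & b' & r' & -> & -> & Hc).
  pose proof (gabs_ge1 t (gmul_neq0_l _ _ Hr)) as Ht.
  exists b', r'. repeat split.
  - eapply gmul_neq0_r; eauto.
  - rewrite gabs_mul in HrT. pose proof (gabs_ge0 r'). nra.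
  - rewrite !toC_mul in Hb.
    replace (Cminus (Cmult (Cmult (toC t) (toC r')) al) (Cmult (toC t) (toC b')))
      with (Cmult (toC t) (Cminus (Cmult (toC r') al) (toC b'))) in Hb by ring.
    rewrite Cmod_mult, <- gabs_Cmod in Hb.
    pose proof (Cmod_ge_0 (Cminus (Cmult (toC r') al) (toC b'))). nra.
  - now apply gcoprime_sym.
Qed.

(** * The sets S_t and the suprema A_t *)

Lemma card_St_le Q S t : t <> g0 ->
  (forall q, S q = true -> q <> g0 /\ IZR (gnorm q) <= INR Q) ->
  (card_St Q S t <= card_S Q S)%nat.
Proof.
  intros Ht HS. unfold card_St, card_S, countP.
  rewrite <- (length_map (gmul t)). apply NoDup_incl_length.
  - apply FinFun.Injective_map_NoDup; [|apply NoDup_filter, NoDup_gbox].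
    intros x y. now apply gmul_cancel.
  - intros q Hq. apply in_map_iff in Hq. destruct Hq as (x & <- & Hx).
    apply filter_In in Hx. destruct Hx as [_ Hx]. apply (proj1 (dec_true _)) in Hx.
    apply filter_In. split; [|now apply (proj2 (dec_true _))].
    destruct (HS _ Hx) as [_ H]. apply in_gbox. rewrite INR_IZR_INZ in H. apply le_IZR in H. nia.
Qed.

Lemma countP_le_of_A_t Q S t u k l B y : Rbar_le (A_t Q S t u k l) (Finite B) ->
  Cmod y <= sqrt (INR Q) / gabs t ->
  INR (countP (gbox Q) (fun q => S (gmul t q) = true /\ Cmod (Cminus (toC q) y) <= u /\ gcong q l k)) <= B.
Proof.
  intros H Hy.
  set (E := fun r => exists y : C, Cmod y <= sqrt (INR Q) / gabs t /\
     r = INR (countP (gbox Q)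
              (fun q => S (gmul t q) = true /\ Cmod (Cminus (toC q) y) <= u /\ gcong q l k))).
  destruct (Lub_Rbar_correct E) as [K _].
  change (Rbar_le (Finite (INR (countP (gbox Q)
     (fun q => S (gmul t q) = true /\ Cmod (Cminus (toC q) y) <= u /\ gcong q l k)))) (Finite B)).
  eapply Rbar_le_trans; [|exact H]. apply K. now exists y.
Qed.

(** * Counting fractions near a point *)

Definition A_t_bound (Q : nat) (S : GI -> bool) (X T : R) (t k : GI) : Prop :=
  forall l u, gcoprime k l -> gabs k * sqrt (INR Q) / (2 * T) <= u -> u <= sqrt (INR Q) / gabs t ->
  Rbar_le (A_t Q S t u k l)
    (Finite ((1 + (INR (card_St Q S t) / IZR (gnorm k)) / (INR Q / (gabs t ^ 2)) * u ^ 2) * X)).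

(** The pair is (q, a). The inequality is |a / q - alpha| <= 1 / T^2 with q cleared and |q| then
    replaced by its bound sqrt Q. *)
Definition near_fraction (Q : nat) (S : GI -> bool) (T : R) (al : C) (p : GI * GI) : Prop :=
  S (fst p) = true /\ gcoprime (snd p) (fst p) /\
  Cmod (Cminus (toC (snd p)) (Cmult (toC (fst p)) al)) <= sqrt (INR Q) / T ^ 2.

(* The numerator [a r - b q] of [a / q - b / r]. *)
Definition cross (r b : GI) (p : GI * GI) : GI := gsub (gmul (snd p) r) (gmul b (fst p)).

(** Both summands are small, one because a / q is near alpha and one because b / r is. This bounds m
    and, for two pairs with equal m, the distance of their q. *)
Lemma toC_cross r b al p : toC (cross r b p) =
  Cplus (Cmult (toC r) (Cminus (toC (snd p)) (Cmult (toC (fst p)) al)))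
        (Cmult (toC (fst p)) (Cminus (Cmult (toC r) al) (toC b))).
Proof. unfold cross. rewrite toC_sub, !toC_mul. ring. Qed.

Lemma cross_inj r b q a1 a2 : r <> g0 -> cross r b (q, a1) = cross r b (q, a2) -> a1 = a2.
Proof.
  unfold cross; simpl. intros Hr H. apply (gmul_cancel r); [assumption|].
  transitivity (gadd (gsub (gmul a1 r) (gmul b q)) (gmul b q)); [ring|]. rewrite H. ring.
Qed.

(** For given m the denominator q determines a, so pairs may be counted by q alone. *)
Lemma NoDup_map_fst_cross r b (F : list (GI * GI)) m : r <> g0 -> NoDup F ->
  (forall p, In p F -> cross r b p = m) -> NoDup (map fst F).
Proof.
  intros Hr HF Hm. apply NoDup_map_NoDup_ForallPairs; [|assumption].
  intros [q1 a1] [q2 a2] H1 H2 E. simpl in E. subst q2. f_equal.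
  apply (cross_inj r b q1); [assumption|]. now rewrite (Hm _ H1), (Hm _ H2).
Qed.

(** One element q0 = t l of the fibre supplies the residue class l mod k for all q' = q / t. It
    remains to find a disc of radius [u] containing all q', with an admissible centre. *)
Lemma fiber_count Q S X T al r b t k m' F om :
  let eta := Cminus (Cmult (toC r) al) (toC b) in
  (1 <= Q)%nat -> (forall q, S q = true -> q <> g0 /\ IZR (gnorm q) <= INR Q) -> 1 <= X -> 1 <= T ->
  r <> g0 -> r = gmul t k -> gcoprime r b -> A_t_bound Q S X T t k ->
  om = Cmod eta \/ om = 2 * gabs r / T ^ 2 -> 2 * gabs r / T ^ 2 <= om -> om <= 4 / T ->
  NoDup F ->
  (forall p, In p F -> near_fraction Q S T al p /\
     (exists q', fst p = gmul t q' /\ gcoprime q' k) /\ cross r b p = gmul t m') ->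
  INR (length F) <= (1 + 4 * INR (card_St Q S t) * gabs t ^ 2 / (T ^ 4 * om ^ 2)) * X.
Proof.
  intros eta HQ HS HX HT Hr Er Hrb HA Hom Hom1 Hom2 HF H.
  assert (Ht : t <> g0) by (rewrite Er in Hr; eapply gmul_neq0_l; eauto).
  assert (Hk : k <> g0) by (rewrite Er in Hr; eapply gmul_neq0_r; eauto).
  pose proof (gabs_ge1 t Ht) as Ht1. pose proof (gabs_ge1 k Hk) as Hk1. pose proof (gabs_ge1 r Hr) as Hr1.
  assert (Hr2 : gabs r = gabs t * gabs k) by (rewrite Er; apply gabs_mul).
  assert (HT2 : 0 < T ^ 2) by (apply pow_lt; lra).
  assert (HrT : 0 < 2 * gabs r / T ^ 2) by (apply Rdiv_lt_0_compat; lra).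
  assert (Hom0 : 0 < om) by lra.
  assert (HQ1 : 1 <= INR Q) by (apply (le_INR 1); assumption).
  assert (HsQ : 1 <= sqrt (INR Q)) by (rewrite <- sqrt_1 at 1; now apply sqrt_le_1_alt).
  (* An empty fibre offers no l; the bound is then just nonnegative. *)
  destruct F as [|[q0 a0] F'].
  { change (INR (length (@nil (GI * GI)))) with 0. pose proof (pos_INR (card_St Q S t)).
    assert (0 <= 4 * INR (card_St Q S t) * gabs t ^ 2 / (T ^ 4 * om ^ 2)); [|apply Rmult_le_pos; lra].
    apply Rmult_le_pos; [apply Rmult_le_pos; [lra|apply pow_le; lra]|].
    apply Rlt_le, Rinv_0_lt_compat, Rmult_lt_0_compat; apply pow_lt; lra. }
  set (F := (q0, a0) :: F') in *.
  destruct (H (q0, a0) (or_introl eq_refl)) as ((N1 & N2 & N3) & (l & L1 & L2) & M0). cbn [fst snd] in N1, N2, N3, L1.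
  set (u := 2 * sqrt (INR Q) * gabs k / (T ^ 2 * om)).
  assert (Hu1 : gabs k * sqrt (INR Q) / (2 * T) <= u).
  { unfold u. apply Rmult_le_reg_l with (2 * T ^ 2 * om); [apply Rmult_lt_0_compat; lra|].
    replace (2 * T ^ 2 * om * (gabs k * sqrt (INR Q) / (2 * T)))
      with ((gabs k * sqrt (INR Q)) * (T * om)) by (field; lra).
    replace (2 * T ^ 2 * om * (2 * sqrt (INR Q) * gabs k / (T ^ 2 * om)))
      with ((gabs k * sqrt (INR Q)) * 4) by (field; lra).
    apply Rmult_le_compat_l; [nra|].
    replace 4 with (T * (4 / T)) by (field; lra). apply Rmult_le_compat_l; lra. }
  assert (Hu2 : u <= sqrt (INR Q) / gabs t).
  { unfold u. apply Rmult_le_reg_l with (T ^ 2 * om * gabs t);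
      [apply Rmult_lt_0_compat; [apply Rmult_lt_0_compat|]; lra|].
    replace (T ^ 2 * om * gabs t * (2 * sqrt (INR Q) * gabs k / (T ^ 2 * om)))
      with (sqrt (INR Q) * (2 * gabs r)) by (rewrite Hr2; field; lra).
    replace (T ^ 2 * om * gabs t * (sqrt (INR Q) / gabs t)) with (sqrt (INR Q) * (T ^ 2 * om)) by (field; lra).
    apply Rmult_le_compat_l; [lra|].
    replace (2 * gabs r) with (T ^ 2 * (2 * gabs r / T ^ 2)) by (field; lra).
    apply Rmult_le_compat_l; lra. }
  assert (HSt : forall q', S (gmul t q') = true -> gabs t * gabs q' <= sqrt (INR Q)).
  { intros q' Hq. rewrite <- gabs_mul. unfold gabs. apply sqrt_le_1_alt, HS, Hq. }
  (* If [om] comes from [eta], centre the disc at [l], itself an element of the fibre; otherwise [u] is the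
     maximal radius [sqrt Q / |t|] and the disc about [0] contains all of [S_t]. *)
  assert (Hy : exists y, Cmod y <= sqrt (INR Q) / gabs t /\
     forall q' a, In (gmul t q', a) F -> Cmod (Cminus (toC q') y) <= u).
  { destruct Hom as [Eo|Eo].
    - exists (toC l). split.
      + rewrite <- gabs_Cmod, <- Rle_div_r by lra. rewrite Rmult_comm. apply HSt. now rewrite <- L1.
      + intros q' a Hin. destruct (H _ Hin) as ((P1 & P2 & P3) & _ & M1). cbn [fst snd] in P1, P2, P3.
        rewrite <- M0 in M1. apply (f_equal toC) in M1. rewrite !(toC_cross r b al) in M1. simpl in M1.
        fold eta in M1. rewrite L1 in M1, N3. rewrite (toC_mul t q'), (toC_mul t l) in M1. rewrite (toC_mul t l) in N3. rewrite (toC_mul t q') in P3.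
        set (e1 := Cminus (toC a) (Cmult (Cmult (toC t) (toC q')) al)) in *.
        set (e0 := Cminus (toC a0) (Cmult (Cmult (toC t) (toC l)) al)) in *.
        (* Both pairs have the same [cross]; this is the difference of its two expansions by
           [toC_cross]. *)
        assert (E : Cmult (Cmult (toC t) (Cminus (toC q') (toC l))) eta = Cmult (toC r) (Cminus e0 e1)).
        { transitivity (Cminus (Cplus (Cmult (toC r) e1) (Cmult (Cmult (toC t) (toC q')) eta))
            (Cplus (Cmult (toC r) e1) (Cmult (Cmult (toC t) (toC l)) eta))); [ring|].
          rewrite M1. ring. }
        apply (f_equal Cmod) in E. rewrite !Cmod_mult, <- !gabs_Cmod, <- Eo in E.
        assert (Cmod (Cminus e0 e1) <= 2 * (sqrt (INR Q) / T ^ 2)).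
        { eapply Rle_trans; [apply Cmod_triangle|]. rewrite Cmod_opp. lra. }
        unfold u. rewrite <- Rle_div_r by (apply Rmult_lt_0_compat; lra).
        set (dd := Cmod (Cminus (toC q') (toC l))) in *.
        apply Rmult_le_reg_l with (gabs t); [lra|].
        replace (gabs t * (dd * (T ^ 2 * om))) with (T ^ 2 * (gabs r * Cmod (Cminus e0 e1)))
          by (rewrite <- E; ring).
        replace (gabs t * (2 * sqrt (INR Q) * gabs k))
          with (T ^ 2 * (gabs r * (2 * (sqrt (INR Q) / T ^ 2)))) by (rewrite Hr2; field; lra).
        apply Rmult_le_compat_l; [lra|]. apply Rmult_le_compat_l; lra.
    - exists (RtoC 0). split.
      + rewrite Cmod_0. apply Rlt_le, Rdiv_lt_0_compat; lra.
      + intros q' a Hin. destruct (H _ Hin) as ((P1 & _) & _). simpl in P1.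
        replace (Cminus (toC q') (RtoC 0)) with (toC q') by ring. rewrite <- gabs_Cmod.
        replace u with (sqrt (INR Q) / gabs t) by (unfold u; rewrite Eo, Hr2; field; lra).
        rewrite <- Rle_div_r by lra. rewrite Rmult_comm. now apply HSt. }
  destruct Hy as (y & Hy1 & Hy2).
  pose proof (countP_le_of_A_t Q S t u k l _ y (HA l u (gcoprime_sym _ _ L2) Hu1 Hu2) Hy1) as HC.
  (* Here u^2 = 4 Q |k|^2 / (T^4 om^2), so both Q and the norm of k cancel. *)
  replace (1 + 4 * INR (card_St Q S t) * gabs t ^ 2 / (T ^ 4 * om ^ 2))
    with (1 + INR (card_St Q S t) / IZR (gnorm k) / (INR Q / gabs t ^ 2) * u ^ 2).
  2:{ rewrite <- (gabs_sqr k). unfold u. rewrite <- (pow2_sqrt (INR Q)) by lra.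
      rewrite (sqrt_pow2 (sqrt _)) by lra. field. repeat split; lra. }
  eapply Rle_trans; [|exact HC]. apply le_INR. unfold countP.
  rewrite <- (length_map fst F), <- (length_map (gmul t) (filter _ _)).
  apply NoDup_incl_length.
  - apply (NoDup_map_fst_cross r b F (gmul t m')); [assumption|assumption|].
    intros p Hp. now apply H.
  - intros q Hq. apply in_map_iff in Hq. destruct Hq as ([q1 a] & E & Hin). simpl in E. subst q1.
    destruct (H _ Hin) as ((P1 & P2 & P3) & (q' & Q1 & Q2) & M1). cbn [fst snd] in P1, P2, P3, Q1. subst q.
    apply in_map_iff. exists q'. split; [reflexivity|]. apply filter_In. split.
    + apply in_gbox_gabs. pose proof (HSt q' P1). pose proof (gabs_ge0 q').
      assert (sqrt (INR Q) <= INR Q).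
      { rewrite <- (sqrt_pow2 (INR Q)) at 2 by lra. apply sqrt_le_1_alt. nra. }
      nra.
    + apply (proj2 (dec_true _)). split; [assumption|]. split; [now apply (Hy2 q' a)|].
      (* Dividing the two [cross] equations by t gives b (q' - l) = (a - a0) k, and k is prime to b
         because it divides r. *)
      apply (gauss k b).
      * intros d D1 D2. apply Hrb; [|assumption]. rewrite Er. now apply gdvd_mul_l.
      * exists (gsub a a0). apply (gmul_cancel t); [assumption|].
        unfold cross in M0, M1; simpl in M0, M1. rewrite L1 in M0.
        transitivity (gsub (gmul t (gmul b q')) (gmul b (gmul t l))); [ring|].
        transitivity (gsub (gmul a r) (gmul a0 r)); [|rewrite Er; ring].
        replace (gmul t (gmul b q')) with (gsub (gmul a r) (gsub (gmul a r) (gmul b (gmul t q')))) by ring.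
        replace (gmul b (gmul t l)) with (gsub (gmul a0 r) (gsub (gmul a0 r) (gmul b (gmul t l)))) by ring.
        rewrite M0, M1. ring.
Qed.

(** From a r = b q and the two coprimalities, q and r divide each other; so q is r times one of four
    units, and q determines a. *)
Lemma zero_cross_count r b (F : list (GI * GI)) : r <> g0 -> gcoprime r b -> NoDup F ->
  (forall p, In p F -> gcoprime (snd p) (fst p) /\ cross r b p = g0) -> INR (length F) <= 4.
Proof.
  intros Hr Hrb HF H.
  replace 4 with (INR (length (map (gmul r) gunits))) by (simpl; ring).
  apply le_INR. rewrite <- (length_map fst F). apply NoDup_incl_length.
  - apply (NoDup_map_fst_cross r b F g0); [assumption|assumption|]. intros p Hp; now apply H.
  - intros q Hq. apply in_map_iff in Hq. destruct Hq as ([q1 a] & E & Hin). simpl in E. subst q1.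
    destruct (H _ Hin) as [H1 H2]. simpl in H1. unfold cross in H2; simpl in H2.
    assert (E : gmul a r = gmul b q).
    { transitivity (gadd (gsub (gmul a r) (gmul b q)) (gmul b q)); [ring|rewrite H2; ring]. }
    destruct (gauss q a r) as [v Hv].
    { now apply gcoprime_sym. } { exists b. rewrite E. ring. }
    destruct (gauss r b q) as [w Hw]; [assumption| |].
    { exists a. rewrite <- E. ring. }
    apply in_map_iff. exists w. split; [now rewrite <- Hw|]. apply gunit_in, gdvd_g1_unit.
    exists v. apply (gmul_cancel r); [assumption|].
    transitivity r; [ring|]. rewrite Hv at 1. rewrite Hw. ring.
Qed.

(** The denominator r depends on [al], so the divisor bound D is required for every r with |r| <= T;
    this makes the final count uniform in [al]. *)
Lemma count_near_fractions Q S X T al D P :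
  (1 <= Q)%nat -> (forall q, S q = true -> q <> g0 /\ IZR (gnorm q) <= INR Q) -> 1 <= X -> 1 <= T ->
  (forall t k, t <> g0 -> k <> g0 -> gabs t * gabs k <= T -> A_t_bound Q S X T t k) ->
  (forall r, r <> g0 -> gabs r <= T -> has_divisors r D) ->
  NoDup P -> (forall p, In p P -> near_fraction Q S T al p) ->
  INR (length P) <= 4 + D * (81 / 4 * INR Q * X * (16 / T ^ 2 + 4 * INR (card_S Q S) / T ^ 4)).
Proof.
  intros HQ HS HX HT HA HD HP Hnear.
  destruct (gdirichlet al T HT) as (b & r & Hr & HrT & Heta & Hrb).
  set (eta := Cminus (Cmult (toC r) al) (toC b)) in *.
  set (s := INR (card_S Q S)).
  set (bnd := 81 / 4 * INR Q * X * (16 / T ^ 2 + 4 * s / T ^ 4)).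
  assert (HT2 : 0 < T ^ 2) by (apply pow_lt; lra).
  assert (HT4 : 0 < T ^ 4) by (apply pow_lt; lra).
  assert (HQ1 : 1 <= INR Q) by (apply (le_INR 1); assumption).
  assert (HsQ : 1 <= sqrt (INR Q)) by (rewrite <- sqrt_1 at 1; now apply sqrt_le_1_alt).
  assert (Hs0 : 0 <= s) by apply pos_INR.
  pose proof (gabs_ge1 r Hr) as Hr1.
  assert (Hbnd : 0 <= bnd).
  { unfold bnd. apply Rmult_le_pos; [nra|].
    apply Rplus_le_le_0_compat; apply Rmult_le_pos; try lra; apply Rlt_le, Rinv_0_lt_compat; assumption. }
  rewrite <- (filter_length (fun p => dec (cross r b p = g0)) P), plus_INR.
  apply Rplus_le_compat.
  { apply (zero_cross_count r b); [assumption|assumption|now apply NoDup_filter|].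
    intros p Hp. apply filter_In in Hp. destruct Hp as [Hp E]. apply (proj1 (dec_true _)) in E.
    split; [apply (Hnear p Hp)|assumption]. }
  set (P1 := filter (fun p => negb (dec (cross r b p = g0))) P).
  assert (HP1 : forall p, In p P1 -> In p P /\ cross r b p <> g0).
  { intros p Hp. apply filter_In in Hp. destruct Hp as [Hp E]. split; [assumption|].
    intros K. apply (proj2 (dec_true _)) in K. rewrite K in E. discriminate. }
  assert (NP1 : NoDup P1) by now apply NoDup_filter.
  set (om := Rmax (Cmod eta) (2 * gabs r / T ^ 2)).
  assert (Hom : om = Cmod eta \/ om = 2 * gabs r / T ^ 2)
    by (unfold om, Rmax; destruct (Rle_dec _ _); auto).
  assert (Hom1 : 2 * gabs r / T ^ 2 <= om) by apply Rmax_r.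
  assert (Hom1' : Cmod eta <= om) by apply Rmax_l.
  assert (Hom0 : 0 < om).
  { eapply Rlt_le_trans; [|exact Hom1]. apply Rdiv_lt_0_compat; lra. }
  assert (Hom2 : om <= 4 / T).
  { unfold om. apply Rmax_lub; [assumption|]. rewrite Rle_div_l by lra.
    replace (4 / T * T ^ 2) with (4 * T) by (field; lra). lra. }
  destruct (HD r Hr HrT) as (ld & D1 & D2).
  apply Rle_trans with (INR (length ld) * bnd); [|now apply Rmult_le_compat_r].
  apply (length_fiber (fun p t => exists q' k, fst p = gmul t q' /\ r = gmul t k /\ gcoprime q' k)).
  { intros p Hp. destruct (gcd_split (fst p) r Hr) as (t & q' & k & E1 & E2 & E3).
    exists t. split; [apply D1; now exists k|now exists q', k]. }
  intros t _. unfold countP. set (Pt := filter _ P1).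
  destruct (classic (gdvd t r)) as [[k Er]|Hn].
  (* The list [ld] may contain elements that do not divide r; their fibres are empty. *)
  2:{ replace Pt with (@nil (GI * GI)); [exact Hbnd|]. symmetry.
      destruct Pt as [|p Pt'] eqn:E; [reflexivity|]. exfalso. apply Hn.
      assert (Hp : In p Pt) by (rewrite E; now left).
      apply filter_In in Hp. destruct Hp as [_ Hp]. apply (proj1 (dec_true _)) in Hp.
      destruct Hp as (q' & k & _ & K & _). now exists k. }
  assert (Ht : t <> g0) by (rewrite Er in Hr; eapply gmul_neq0_l; eauto).
  assert (Hk : k <> g0) by (rewrite Er in Hr; eapply gmul_neq0_r; eauto).
  pose proof (gabs_ge1 t Ht) as Ht1.
  assert (HPt : forall p, In p Pt -> In p P1 /\ exists q', fst p = gmul t q' /\ gcoprime q' k).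
  { intros p Hp. apply filter_In in Hp. destruct Hp as [Hp E]. apply (proj1 (dec_true _)) in E.
    destruct E as (q' & k' & E1 & E2 & E3). split; [assumption|]. exists q'. split; [assumption|].
    replace k with k'; [assumption|]. apply (gmul_cancel t); [assumption|]. now rewrite <- E2. }
  (* In |t m'| the distance of a / q from alpha accounts for at most sqrt Q om / 2, as 2 |r| / T^2
     <= om, and the error of b / r for at most sqrt Q om; together 3/2. *)
  set (Y := 3 / 2 * sqrt (INR Q) * om / gabs t).
  assert (HY : 0 <= Y).
  { apply Rlt_le, Rdiv_lt_0_compat; [|lra]. apply Rmult_lt_0_compat; lra. }
  destruct (lattice_disc Y HY) as (lm & M1 & M2).
  set (B := (1 + 4 * INR (card_St Q S t) * gabs t ^ 2 / (T ^ 4 * om ^ 2)) * X).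
  assert (HB : 0 <= B).
  { unfold B. pose proof (pos_INR (card_St Q S t)).
    assert (0 <= 4 * INR (card_St Q S t) * gabs t ^ 2 / (T ^ 4 * om ^ 2)); [|apply Rmult_le_pos; lra].
    apply Rmult_le_pos; [apply Rmult_le_pos; [lra|apply pow_le; lra]|].
    apply Rlt_le, Rinv_0_lt_compat, Rmult_lt_0_compat; [lra|apply pow_lt; lra]. }
  apply Rle_trans with (INR (length lm) * B).
  - apply (length_fiber (fun p m' => cross r b p = gmul t m')).
    + intros [q a] Hp. destruct (HPt _ Hp) as (Hp1 & q' & E1 & E2). simpl in E1.
      destruct (HP1 _ Hp1) as [HpP Hc].
      assert (exists m', cross r b (q, a) = gmul t m') as [m' Hm].
      { unfold cross; simpl. exists (gsub (gmul a k) (gmul b q')). rewrite E1, Er. ring. }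
      exists m'. split; [|assumption]. apply M1.
      { intros K. apply Hc. rewrite Hm, K. ring. }
      unfold Y. rewrite <- Rle_div_r by lra. rewrite Rmult_comm, <- gabs_mul, <- Hm, gabs_Cmod, (toC_cross r b al).
      fold eta. simpl. destruct (Hnear _ HpP) as (N1 & _ & N3). cbn [fst snd] in N1, N3.
      eapply Rle_trans; [apply Cmod_triangle|]. rewrite !Cmod_mult, <- !gabs_Cmod.
      assert (Hq : gabs q <= sqrt (INR Q)) by (unfold gabs; apply sqrt_le_1_alt, HS, N1).
      assert (gabs r * Cmod (Cminus (toC a) (Cmult (toC q) al)) <= sqrt (INR Q) * (om / 2)).
      { apply Rle_trans with (gabs r * (sqrt (INR Q) / T ^ 2)); [apply Rmult_le_compat_l; lra|].
        replace (gabs r * (sqrt (INR Q) / T ^ 2)) with (sqrt (INR Q) * (2 * gabs r / T ^ 2 / 2)) by (field; lra).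
        apply Rmult_le_compat_l; lra. }
      assert (gabs q * Cmod eta <= sqrt (INR Q) * om).
      { apply Rmult_le_compat; [apply gabs_ge0|apply Cmod_ge_0|assumption|assumption]. }
      lra.
    + intros m' _. unfold countP.
      apply (fiber_count Q S X T al r b t k m'); try assumption.
      * apply HA; [assumption|assumption|]. rewrite <- gabs_mul, <- Er. assumption.
      * now apply NoDup_filter, NoDup_filter.
      * intros p Hp. apply filter_In in Hp. destruct Hp as [Hp E]. apply (proj1 (dec_true _)) in E.
        destruct (HPt _ Hp) as [Hp1 Hq]. split; [apply Hnear; now apply HP1|]. now split.
  (* Here 81/4 is 9 (3/2)^2, and 16 / T^2 comes from om <= 4 / T together with |t| >= 1. *)
  - apply Rle_trans with (9 * Y ^ 2 * B); [now apply Rmult_le_compat_r|].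
    assert (EY : Y ^ 2 = 9 / 4 * INR Q * om ^ 2 / gabs t ^ 2).
    { unfold Y. rewrite <- (pow2_sqrt (INR Q)) at 2 by lra. field. lra. }
    rewrite EY. unfold B, bnd.
    set (st := INR (card_St Q S t)).
    replace (9 * (9 / 4 * INR Q * om ^ 2 / gabs t ^ 2) * ((1 + 4 * st * gabs t ^ 2 / (T ^ 4 * om ^ 2)) * X))
      with (81 / 4 * INR Q * X * (om ^ 2 / gabs t ^ 2 + 4 * st / T ^ 4)) by (field; repeat split; lra).
    apply Rmult_le_compat_l; [nra|]. apply Rplus_le_compat.
    + apply Rle_trans with (om ^ 2).
      * rewrite Rle_div_l by nra. assert (0 <= om ^ 2) by apply pow2_ge_0.
        assert (1 <= gabs t ^ 2) by nra. nra.
      * replace (16 / T ^ 2) with ((4 / T) ^ 2) by (field; lra). apply pow_incr. lra.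
    + apply Rmult_le_compat_r; [apply Rlt_le, Rinv_0_lt_compat; assumption|].
      assert (st <= s) by (apply le_INR, card_St_le; assumption). lra.
Qed.

(** * From the counting bound to the large sieve bound *)

(** Picks one y for each x without losing any in the count; it serves to move every fraction to a
    translate lying near alpha. *)
Lemma list_choice {A B} (R : A -> B -> Prop) (l : list A) :
  NoDup l -> (forall x, In x l -> exists y, R x y) ->
  (forall x x' y, In x l -> In x' l -> R x y -> R x' y -> x = x') ->
  exists l', NoDup l' /\ length l' = length l /\ forall y, In y l' -> exists x, In x l /\ R x y.
Proof.
  induction 1 as [|x l Hx Hl IH]; intros Hex Hinj.
  - exists nil. repeat split; [constructor|intros y []].
  - destruct IH as (l' & L1 & L2 & L3).
    { intros z Hz. apply Hex. now right. }
    { intros z z' y Hz Hz'. apply Hinj; now right. }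
    destruct (Hex x (or_introl eq_refl)) as [y Hy]. exists (y :: l'). split; [|split].
    + constructor; [|assumption]. intros Hin. destruct (L3 y Hin) as (z & Hz & Hzy).
      apply Hx. replace x with z; [assumption|].
      apply (Hinj z x y); [now right|now left|assumption|assumption].
    + simpl. now rewrite L2.
    + intros z [<-|Hz]; [exists x; split; [now left|assumption]|].
      destruct (L3 z Hz) as (w & W1 & W2). exists w. split; [now right|assumption].
Qed.

Lemma in_flat_map_pair {A B} (g : A -> list B) l q b :
  In (q, b) (flat_map (fun q => map (pair q) (g q)) l) <-> In q l /\ In b (g q).
Proof.
  rewrite in_flat_map. split.
  - intros (q' & H1 & H2). apply in_map_iff in H2. destruct H2 as (b' & E & H3).
    injection E as -> ->. now split.
  - intros [H1 H2]. exists q. split; [assumption|]. now apply in_map.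
Qed.

Lemma NoDup_flat_map_pair {A B} (g : A -> list B) l :
  NoDup l -> (forall q, NoDup (g q)) -> NoDup (flat_map (fun q => map (pair q) (g q)) l).
Proof.
  intros Hl Hg. induction Hl as [|q l Hq Hl IH]; simpl; [constructor|].
  apply NoDup_app; [|assumption|].
  - apply FinFun.Injective_map_NoDup; [|apply Hg]. intros x y E. congruence.
  - intros [q' b] H1 H2. apply in_map_iff in H1. destruct H1 as (b' & E & _).
    injection E as -> _. now apply in_flat_map_pair in H2.
Qed.

Lemma sumR_flat_map_pair {A B} (g : A -> list B) l (f : A * B -> R) :
  sumR (flat_map (fun q => map (pair q) (g q)) l) f = sumR l (fun q => sumR (g q) (fun b => f (q, b))).
Proof.
  induction l as [|q l IH]; simpl; [reflexivity|]. now rewrite sumR_app, sumR_map, IH.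
Qed.

Lemma complete_residues_NoDup q r : complete_residues q r -> NoDup r.
Proof.
  intros [_ H]. induction H as [|b r Hb Hr IH]; constructor; [|assumption].
  intros Hin. rewrite Forall_forall in Hb. apply (Hb b Hin). exists g0. ring.
Qed.

Lemma complete_residues_inj q r b c : complete_residues q r -> In b r -> In c r ->
  gcong b c q -> b = c.
Proof.
  intros [_ H] Hb Hc Hbc.
  destruct (ForallOrdPairs_In H b c Hb Hc) as [E|[E|E]]; [assumption|tauto|].
  (* [ForallOrdPairs] compares each pair in one order only, so congruence has to be reversed. *)
  exfalso. apply E. destruct Hbc as [m Hm]. exists (gopp m).
  transitivity (gopp (gsub b c)); [ring|rewrite Hm; ring].
Qed.

(** Re (n z) = n_1 Re z - n_2 Im z, so the torus point attached to z = b / q is (Re z, - Im z). *)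
Lemma expsum_chi N a q b : expsum N a q b =
  sumC (gdisc N) (fun n => Cmult (a n) (chi n (fst (Cdiv (toC b) (toC q))) (- snd (Cdiv (toC b) (toC q))))).
Proof.
  unfold expsum. apply sumC_ext. intros n. f_equal. unfold chi. f_equal.
  replace (Cdiv (Cmult (toC n) (toC b)) (toC q)) with (Cmult (toC n) (Cdiv (toC b) (toC q)))
    by (unfold Cdiv; ring).
  unfold Re, Cmult, toC; simpl fst; simpl snd. ring.
Qed.

(** The condition 2 T^4 <= W^2 makes the diagonal sqrt 2 / W of a cell at most 1 / T^2. Signs of
    second coordinates flip because the torus point carries - Im; adding a multiple of q keeps b
    prime to q. *)
Lemma in_cell_near_fraction Q S T W q b u v : q <> g0 -> S q = true -> gcoprime b q ->
  gabs q <= sqrt (INR Q) -> 0 < T -> 0 < W -> 2 * T ^ 4 <= W ^ 2 ->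
  in_cell W u v (fst (Cdiv (toC b) (toC q))) (- snd (Cdiv (toC b) (toC q))) ->
  exists c, near_fraction Q S T (u, - v) (q, gadd b (gmul q c)).
Proof.
  intros Hq HSq Hb HqQ HT HW HTW (m & n & H1 & H2). exists (m, (- n)%Z).
  split; [assumption|]. split; cbn [fst snd].
  - intros d D1 D2. apply Hb; [|assumption].
    replace b with (gsub (gadd b (gmul q (m, (- n)%Z))) (gmul q (m, (- n)%Z))) by ring.
    apply gdvd_sub; [assumption|]. now apply gdvd_mul_r.
  - set (z := Cdiv (toC b) (toC q)) in *.
    pose proof (gabs_ge1 q Hq) as Hq1.
    assert (Hqz : toC q <> RtoC 0).
    { intros E. rewrite gabs_Cmod, E, Cmod_0 in Hq1. lra. }
    assert (E : toC (gadd b (gmul q (m, (- n)%Z))) = Cmult (toC q) (Cplus z (toC (m, (- n)%Z)))).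
    { replace (gadd b (gmul q (m, (- n)%Z))) with (gsub b (gmul q (gopp (m, (- n)%Z)))) by ring.
      rewrite toC_sub, toC_mul.
      replace (toC (gopp (m, (- n)%Z))) with (Copp (toC (m, (- n)%Z)))
        by (unfold toC, gopp, Copp; simpl; now rewrite !opp_IZR).
      unfold z. field. assumption. }
    rewrite E.
    replace (Cminus (Cmult (toC q) (Cplus z (toC (m, (- n)%Z)))) (Cmult (toC q) (u, - v)))
      with (Cmult (toC q) (Cminus (Cplus z (toC (m, (- n)%Z))) (u, - v))) by ring.
    rewrite Cmod_mult, <- gabs_Cmod. unfold Rdiv.
    assert (HT2 : 0 < T ^ 2) by (apply pow_lt; assumption).
    assert (0 < / T ^ 2) by now apply Rinv_0_lt_compat.
    apply Rmult_le_compat; [apply gabs_ge0|apply Cmod_ge_0|assumption|].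
    apply Cmod_le_sqr; [lra|].
    unfold Cminus, Cplus, Copp, toC; cbn [fst snd]. rewrite opp_IZR.
    assert (2 * (1 / W) ^ 2 <= (/ T ^ 2) ^ 2).
    { apply Rmult_le_reg_l with (W ^ 2 * T ^ 4); [apply Rmult_lt_0_compat; apply pow_lt; assumption|].
      replace (W ^ 2 * T ^ 4 * (2 * (1 / W) ^ 2)) with (2 * T ^ 4) by (field; lra).
      replace (W ^ 2 * T ^ 4 * (/ T ^ 2) ^ 2) with (W ^ 2) by (field; lra). assumption. }
    assert ((fst z + IZR m + - u) ^ 2 <= (1 / W) ^ 2) by (apply pow_incr; lra).
    replace (snd z + - IZR n + - - v) with (- (- snd z + IZR n - v)) by ring.
    assert ((- snd z + IZR n - v) ^ 2 <= (1 / W) ^ 2) by (apply pow_incr; lra).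
    replace ((- (- snd z + IZR n - v)) ^ 2) with ((- snd z + IZR n - v) ^ 2) by ring. lra.
Qed.

Lemma gdisc_in_gbox N n : In n (gdisc N) -> In n (gbox (Nat.sqrt N)).
Proof.
  intros H. apply filter_In in H. destruct H as [_ H]. apply Z.leb_le in H. apply in_gbox.
  pose proof (Nat.sqrt_spec N ltac:(lia)). nia.
Qed.

Theorem theorem2 :
  forall eps : R, 0 < eps ->
  exists c2 : R, 0 < c2 /\
  forall (Q N : nat) (a : GI -> C) (S : GI -> bool) (X : R)
         (res : GI -> list GI),
    (1 <= Q)%nat -> (1 <= N)%nat ->
    (forall q, S q = true -> q <> g0 /\ IZR (gnorm q) <= INR Q) ->
    1 <= X ->
    (forall q, S q = true -> complete_residues q (res q)) ->
    (forall (t k l : GI) (u : R),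
        t <> g0 -> gabs t <= sqrt (sqrt (INR N)) ->
        k <> g0 -> gabs k <= sqrt (sqrt (INR N)) / gabs t ->
        gcoprime k l ->
        gabs k * sqrt (INR Q) / (2 * sqrt (sqrt (INR N))) <= u ->
        u <= sqrt (INR Q) / gabs t ->
        Rbar_le (A_t Q S t u k l)
          (Finite ((1 + (INR (card_St Q S t) / IZR (gnorm k))
                          / (INR Q / (gabs t ^ 2)) * u ^ 2) * X))) ->
    sumR (gbox Q) (fun q => if S q then
        sumR (res q) (fun b => if dec (gcoprime b q) then
                 Cmod (expsum N a q b) ^ 2 else 0)
      else 0)
    <= c2 * (INR N + INR Q * X * Rpower (INR N) eps
                       * (sqrt (INR N) + INR (card_S Q S)))
          * sumR (gdisc N) (fun n => Cmod (a n) ^ 2).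
Proof.
  intros eps Heps. destruct (divisor_bound eps Heps) as (c & Hc & Hdiv).
  (* 22500 is 2500 times the 9 of W^2 <= 9 N, 4 is the contribution of m = 0, and 324 is (81/4) 16,
     which also covers the coefficient 81 of |S|. *)
  exists (22500 * (4 + 324 * c)). split; [lra|].
  intros Q N a S X res HQ HN HS HX Hres HA.
  set (T := sqrt (sqrt (INR N))) in *.
  assert (HN1 : 1 <= INR N) by (apply (le_INR 1); assumption).
  assert (HQ1 : 1 <= INR Q) by (apply (le_INR 1); assumption).
  assert (HsN : 1 <= sqrt (INR N)) by (rewrite <- sqrt_1 at 1; now apply sqrt_le_1_alt).
  assert (HT : 1 <= T) by (unfold T; rewrite <- sqrt_1 at 1; now apply sqrt_le_1_alt).
  assert (ET2 : sqrt (INR N) = T ^ 2) by (unfold T; rewrite pow2_sqrt; lra).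
  assert (ET4 : INR N = T ^ 4).
  { rewrite <- (pow2_sqrt (INR N)) by lra. rewrite ET2. ring. }
  set (s := INR (card_S Q S)). assert (Hs : 0 <= s) by apply pos_INR.
  set (M := Nat.sqrt N). set (W := 2 * INR M + 1).
  assert (HM : (1 <= M)%nat) by (apply Nat.sqrt_le_square; lia).
  (* N <= M^2 + 2 M gives 2 N <= (2 M + 1)^2; conversely M >= 1 and M^2 <= N give (2 M + 1)^2 <= 9
     N. *)
  assert (HWlo : 2 * T ^ 4 <= W ^ 2).
  { rewrite <- ET4. pose proof (Nat.sqrt_spec N ltac:(lia)) as [_ K]. fold M in K.
    assert (N <= M * M + 2 * M)%nat as K2 by lia. apply le_INR in K2.
    rewrite plus_INR, !mult_INR in K2. simpl (INR 2) in K2. unfold W. nra. }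
  assert (HWhi : W ^ 2 <= 9 * INR N).
  { pose proof (Nat.sqrt_spec N ltac:(lia)) as [K _]. fold M in K. apply le_INR in K.
    rewrite mult_INR in K. apply (le_INR 1) in HM. simpl in HM. unfold W. nra. }
  assert (HW : 1 <= W) by (pose proof (pos_INR M); unfold W; lra).
  set (g := fun q => if S q then filter (fun b => dec (gcoprime b q)) (res q) else []).
  set (Pts := flat_map (fun q => map (pair q) (g q)) (gbox Q)).
  assert (Hg : forall q b, In b (g q) -> S q = true /\ In b (res q) /\ gcoprime b q).
  { intros q b H. unfold g in H. destruct (S q) eqn:E; [|destruct H].
    apply filter_In in H. destruct H as [H1 H2]. apply (proj1 (dec_true _)) in H2. tauto. }
  assert (HPts : NoDup Pts).
  { apply NoDup_flat_map_pair; [apply NoDup_gbox|]. intros q. unfold g.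
    destruct (S q) eqn:E; [|constructor]. apply NoDup_filter.
    now apply (complete_residues_NoDup q), Hres. }
  set (zeta := fun p : GI * GI => Cdiv (toC (snd p)) (toC (fst p))).
  set (Z := sumR (gdisc N) (fun n => Cmod (a n) ^ 2)).
  assert (HZ : 0 <= Z) by (apply sumR_nonneg; intros; apply pow2_ge_0).
  set (pe := Rpower (INR N) eps). assert (Hpe : 0 < pe) by apply exp_pos.
  set (K := 4 + c * pe * (81 / 4 * INR Q * X * (16 / T ^ 2 + 4 * s / T ^ 4))).
  assert (Hrem : 0 <= INR Q * X * (16 / T ^ 2 + 4 * s / T ^ 4)).
  { apply Rmult_le_pos; [nra|]. apply Rplus_le_le_0_compat; apply Rmult_le_pos; try lra;
      apply Rlt_le, Rinv_0_lt_compat, pow_lt; lra. }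
  assert (HK : 0 < K).
  { unfold K. assert (0 < c * pe) by now apply Rmult_lt_0_compat. nra. }
  assert (Hcount : forall u v, INR (countP Pts (fun p => in_cell W u v (fst (zeta p)) (- snd (zeta p)))) <= K).
  { intros u v. unfold countP. set (F := filter _ Pts).
    assert (HF : forall p, In p F -> In (snd p) (g (fst p)) /\ in_cell W u v (fst (zeta p)) (- snd (zeta p))).
    { intros [q b] H. apply filter_In in H. destruct H as [H1 H2]. apply (proj1 (dec_true _)) in H2.
      apply in_flat_map_pair in H1. now split. }
    (* A pair (q, b) meets the cell only modulo 1; it is replaced by the pair (q, b + q d) that is
       truly near the corner. *)
    destruct (list_choice (fun p p' : GI * GI =>
        (exists d, p' = (fst p, gadd (snd p) (gmul (fst p) d))) /\ near_fraction Q S T (u, - v) p') F)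
      as (P & HP & EP & HP').
    - now apply NoDup_filter.
    - intros [q b] H. destruct (HF _ H) as [H1 H2]. cbn [fst snd] in H1, H2.
      destruct (Hg _ _ H1) as (G1 & G2 & G3). destruct (HS _ G1) as [G4 G5].
      destruct (in_cell_near_fraction Q S T W q b u v) as [d Hd]; try assumption; try lra.
      { unfold gabs. now apply sqrt_le_1_alt. }
      exists (q, gadd b (gmul q d)). split; [now exists d|assumption].
    (* Residues with a common translate are congruent modulo q, hence equal in a complete system. *)
    - intros [q b] [q' b'] y H H' [[d Hd] _] [[d' Hd'] _]. cbn [fst snd] in Hd, Hd'.
      rewrite Hd in Hd'. injection Hd' as <- Eb1 Eb2. f_equal.
      assert (Eb : gadd b (gmul q d) = gadd b' (gmul q d')) by (unfold gadd, gmul; simpl; now rewrite Eb1, Eb2).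
      destruct (HF _ H) as [H1 _]. destruct (HF _ H') as [H1' _]. cbn [fst snd] in H1, H1'.
      destruct (Hg _ _ H1) as (G1 & G2 & _). destruct (Hg _ _ H1') as (_ & G2' & _).
      apply (complete_residues_inj q (res q)); [now apply Hres|assumption|assumption|].
      exists (gsub d' d).
      transitivity (gsub (gsub (gadd b (gmul q d)) (gmul q d)) b'); [ring|]. rewrite Eb. ring.
    - rewrite <- EP.
      apply (count_near_fractions Q S X T (u, - v) (c * pe) P); try assumption.
      + intros t k Ht Hk Htk l w Hl W1 W2.
        pose proof (gabs_ge1 t Ht). pose proof (gabs_ge1 k Hk).
        apply HA; try assumption; [nra|]. rewrite <- Rle_div_r by lra. lra.
      (* The norm of r is at most T^2 <= N, so the divisor bound becomes c N^eps for all such r. *)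
      + intros r Hr HrT. destruct (Hdiv r Hr) as (l & L1 & L2). exists l. split; [assumption|].
        eapply Rle_trans; [exact L2|]. apply Rmult_le_compat_l; [lra|].
        unfold pe. apply Rle_Rpower_l; [lra|]. rewrite <- gabs_sqr.
        pose proof (gabs_ge1 r Hr). split; [nra|]. rewrite ET4. nra.
      + intros p Hp. destruct (HP' p Hp) as (_ & _ & _ & Hn). assumption. }
  assert (Hsieve := large_sieve Pts (fun p => fst (zeta p)) (fun p => - snd (zeta p)) a N M K
    (gdisc_in_gbox N) HK Hcount).
  cbv zeta in Hsieve. fold W Z in Hsieve.
  replace (sumR (gbox Q) _) with (sumR Pts (fun p =>
    Cmod (sumC (gdisc N) (fun n => Cmult (a n) (chi n (fst (zeta p)) (- snd (zeta p))))) ^ 2)).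
  2:{ unfold Pts. rewrite sumR_flat_map_pair. apply sumR_ext. intros q _. unfold g.
      destruct (S q); [|reflexivity]. rewrite sumR_filter. apply sumR_ext. intros b _.
      destruct (dec (gcoprime b q)); [|reflexivity]. now rewrite expsum_chi. }
  eapply Rle_trans; [exact Hsieve|]. apply Rmult_le_compat_r; [assumption|].
  apply Rle_trans with (2500 * (9 * INR N) * K).
  { apply Rmult_le_compat_r; lra. }
  unfold K. rewrite ET2, ET4.
  replace (2500 * (9 * T ^ 4) * (4 + c * pe * (81 / 4 * INR Q * X * (16 / T ^ 2 + 4 * s / T ^ 4))))
    with (22500 * (4 * T ^ 4 + c * (INR Q * X * pe * (324 * T ^ 2 + 81 * s)))) by (field; lra).
  assert (0 <= INR Q * X * pe) by (apply Rmult_le_pos; nra).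
  assert (0 < T ^ 2) by (apply pow_lt; lra). assert (0 < T ^ 4) by (apply pow_lt; lra).
  set (V := INR Q * X * pe) in *.
  assert (0 <= V * (T ^ 2 + s)) by (apply Rmult_le_pos; lra).
  assert (c * (V * (324 * T ^ 2 + 81 * s)) <= 324 * c * (V * (T ^ 2 + s))).
  { replace (324 * c * (V * (T ^ 2 + s))) with (c * (V * (324 * T ^ 2 + 324 * s))) by ring.
    apply Rmult_le_compat_l; [lra|]. apply Rmult_le_compat_l; lra. }
  assert (0 <= c * T ^ 4) by (apply Rmult_le_pos; lra).
  lra.
Qed.
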